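(* Let $X$ be a three-dimensional real Banach space whose norm has no fixed-direction cylindrical open cone, and suppose that for some $e\in S_X$ the set $\operatorname{St}_X(e)=\{u\in S_X:\|e+u\|=2\}$ has nonempty interior relative to $S_X$. Then $X$ has the Mazur--Ulam property.
   Context: For a real Banach space $X$, $S_X$ denotes its unit sphere. A real Banach space $X$ has the Mazur--Ulam property if for every real Banach space $Y$, every surjective isometry $f:S_X\to S_Y$ extends to a surjective real-linear isometry $X\to Y$. A norm $N$ on $X$ has a fixed-direction cylindrical open cone if there are a nonzero $k\in X$ and a nonempty open cone $\Gamma\subset X\setminus\{0\}$ (an open set closed under multiplication by positive scalars) such that $N(z+tk)=N(z)$ whenever the segment $[z,z+tk]$ (with $z\in X$, $t\in\mathbb R$) is compactly contained in $\Gamma$; the vector $k$ is fixed throughout $\Gamma$. *)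

(* Defs.v *)
From HB Require Import structures.
From mathcomp Require Import all_boot all_order all_algebra.
From mathcomp Require Import all_classical all_reals all_analysis.

Set Implicit Arguments.
Unset Strict Implicit.
Unset Printing Implicit Defensive.
Import Order.TTheory GRing.Theory Num.Theory.
Import numFieldNormedType.Exports.
Local Open Scope classical_set_scope.
Local Open Scope ring_scope.

Definition unit_sphere (R : realType) (X : normedModType R) : set X :=
  [set x | `|x| = 1].

Definition isometry_on (R : realType) (X Y : normedModType R) (A : set X)
    (f : X -> Y) : Prop :=
  forall x y, A x -> A y -> `|f x - f y| = `|x - y|.

(* A map between the spheres is a total map X -> Y, of which only the values
   on the unit sphere matter. *)
Definition Mazur_Ulam_property (R : realType) (X : completeNormedModType R) :
    Prop :=
  forall (Y : completeNormedModType R) (f : X -> Y),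
    set_fun (@unit_sphere R X) (@unit_sphere R Y) f ->
    set_surj (@unit_sphere R X) (@unit_sphere R Y) f ->
    isometry_on (@unit_sphere R X) f ->
  exists T : {linear X -> Y},
    [/\ set_surj [set: X] [set: Y] T, isometry_on [set: X] T &
        forall x, unit_sphere x -> T x = f x].

Definition open_cone (R : realType) (X : normedModType R) (G : set X) : Prop :=
  open G /\ forall (a : R) (x : X), 0 < a -> G x -> G (a *: x).

Definition segment (R : realType) (X : normedModType R) (x y : X) : set X :=
  [set (1 - s) *: x + s *: y | s in `[0%R, 1%R]%classic].

Definition compactly_contained (T : topologicalType) (A B : set T) : Prop :=
  compact (closure A) /\ closure A `<=` B.

Definition fixed_direction_cylindrical_open_cone
    (R : realType) (X : normedModType R) : Prop :=
  exists (k : X) (G : set X),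
    [/\ k != 0, G !=set0, open_cone G, ~ G 0 &
        forall (z : X) (t : R),
          compactly_contained (segment z (z + t *: k)) G ->
          `|z + t *: k| = `|z| ].

Definition star (R : realType) (X : normedModType R) (e : X) : set X :=
  [set u | unit_sphere u /\ `|e + u| = 2].

(* In [subspace S] the points outside S are isolated, so for A included in S
   this is the interior of A for the topology induced on S. *)
Definition relative_interior (T : topologicalType) (S A : set T) : set T :=
  @interior (subspace S) A.

(* Main.v *)
Require Import Defs.
From HB Require Import structures.
From mathcomp Require Import all_boot all_order all_algebra.
From mathcomp Require Import all_classical all_reals all_analysis.
From mathcomp Require Import ring lra.
Import Order.TTheory GRing.Theory Num.Theory.
Import numFieldNormedType.Exports.
Local Open Scope classical_set_scope.
Local Open Scope ring_scope.

Set Implicit Arguments.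
Unset Strict Implicit.
Unset Printing Implicit Defensive.

(** Write N for the norm of X, and let F : X -> Y be the positively homogeneous
    extension of the given sphere isometry f. Since |F x - F y| = |x - y| when
    |x| = |y|, also |F x + P y| = |x + y| for the companion isometry
    P x := - F (- x). It is not known beforehand that f is odd, i.e. P = F, nor
    that Y has dimension three; both come out of the proof.

    The absence of cylinders is used only in the following form: a vector k such
    that N (z + s k) >= N z for all z in a nonempty open cone and all s is zero
    ([flat_direction_eq0]). Indeed N is then constant along k inside the cone.

    A linear patch. If the star of e has interior, N (z + t e) = N z + t for
    t >= 0 on an open cone Gam. For a unit vector u in Gam the star of u lies on
    the ray from e through u ([star_ray]): a star point off the plane of e and u
    would make N linear on an open cone, hence cylindrical. Metrically,
    F maps the star of u onto the star of P u and P maps it onto the star of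
    F u. The latter star contains the segment from P e to F u, so this segment
    is the P-image of an initial piece of the ray ([opp_segment]). Comparing two
    rays gives P e = F e, whence P = F on Gam and F (z + t e) = F z + t F e.
    Shifting by multiples of e makes norms equal, and the isometry condition
    becomes N (F z + t F w) = N (z + t w) for small t: F preserves directional
    derivatives of the norm in directions taken from Gam. If F w3 = F w1 + F w2,
    then at the points where both norms are almost differentiable, which are
    dense, the derivative in the direction w3 - w1 - w2 almost vanishes. So that
    vector is a flat direction, w3 = w1 + w2, and F is additive on a small cone
    ([locally_additive]). Thus F and P agree with a bijective linear T on an
    open cone ([linear_patch]).

    Propagation. Let E be the set where F and P both agree with T, and let x0 be
    in the closure of an open convex cone K contained in E. If points x near x0
    had F (- x) <> - T x, put T g = - F (- x); then g <> x, and the distances to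
    the points u of K give N (u + g) = N (u + x). As x tends to x0, a limit k of
    the directions of g - x satisfies N (z + s k) >= N z for the points
    z = u + x0, which fill an open cone ([no_pairs_at_equal_distance]). This
    contradicts the absence of cylinders, so E contains a neighbourhood of x0
    ([agreement_neighbourhood]). If E were not everything, a path leaving E and
    a bad point nearest to a good point of this path would produce such a K with
    x0 bad ([agreement_all]). Hence F = T. *)

(** * Identities between vectors *)

Section LinearIdentities.
Context {R : comPzRingType} {V : lmodType R}.

(** Formal linear combinations of vectors. They reduce an identity in a module
    to the equality of the scalar coefficients of each atom, which [ring] or
    [field] then proves; see the tactics [vec] and [vfield]. *)
Inductive vexpr :=
  | VAtom of nat
  | VZero
  | VAdd of vexpr & vexpr
  | VOpp of vexpr
  | VScale of R & vexpr.

Fixpoint veval (env : seq V) (u : vexpr) : V :=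
  match u with
  | VAtom i => env`_i
  | VZero => 0
  | VAdd u v => veval env u + veval env v
  | VOpp u => - veval env u
  | VScale a u => a *: veval env u
  end.

Fixpoint vcoef (u : vexpr) (i : nat) : R :=
  match u with
  | VAtom j => if (j == i)%N then 1 else 0
  | VZero => 0
  | VAdd u v => vcoef u i + vcoef v i
  | VOpp u => - vcoef u i
  | VScale a u => a * vcoef u i
  end.

Fixpoint vbounded (n : nat) (u : vexpr) : bool :=
  match u with
  | VAtom i => (i < n)%N
  | VZero => true
  | VAdd u v => vbounded n u && vbounded n v
  | VOpp u => vbounded n u
  | VScale _ u => vbounded n u
  end.

Fixpoint same_coefs (n : nat) (u v : vexpr) : Prop :=
  if n is m.+1 then vcoef u m = vcoef v m /\ same_coefs m u v else True.

Lemma vevalE env u : vbounded (size env) u ->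
  veval env u = \sum_(i < size env) vcoef u i *: env`_i.
Proof.
elim: u => [j|_|u IHu v IHv /andP[bu bv]|u IHu bu|a u IHu bu] /=.
- move=> lt_j; rewrite (bigD1 (Ordinal lt_j)) //= eqxx scale1r big1 ?addr0 //.
  by move=> i; rewrite -val_eqE /= eq_sym => /negbTE ->; rewrite scale0r.
- by rewrite big1 // => i _; rewrite scale0r.
- by rewrite IHu // IHv // -big_split; apply: eq_bigr => i _; rewrite scalerDl.
- by rewrite IHu // -sumrN; apply: eq_bigr => i _; rewrite scaleNr.
- by rewrite IHu // scaler_sumr; apply: eq_bigr => i _; rewrite scalerA.
Qed.

Lemma veval_eq env u v : vbounded (size env) u && vbounded (size env) v ->
  same_coefs (size env) u v -> veval env u = veval env v.
Proof.
case/andP=> bu bv coef_uv; rewrite !vevalE //; apply: eq_bigr => i _.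
congr (_ *: _); case: i => i /=.
elim: (size env) coef_uv => // n IHn [uv_n /IHn{}IHn].
by rewrite ltnS leq_eqVlt => /predU1P[-> //|].
Qed.

End LinearIdentities.

Ltac vec_index x env :=
  lazymatch env with
  | x :: _ => constr:(0%N)
  | _ :: ?l => let n := vec_index x l in constr:(S n)
  end.

Ltac vec_atoms t env :=
  lazymatch t with
  | 0 => env
  | ?x + ?y => let l := vec_atoms x env in vec_atoms y l
  | - ?x => vec_atoms x env
  | _ *: ?x => vec_atoms x env
  | _ => match constr:(true) with
         | _ => let _ := vec_index t env in env
         | _ => constr:(t :: env)
         end
  end.

Ltac vec_reify t env :=
  lazymatch t with
  | 0 => open_constr:(VZero)
  | ?x + ?y =>
      let u := vec_reify x env in
      let v := vec_reify y env in open_constr:(VAdd u v)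
  | - ?x => let u := vec_reify x env in open_constr:(VOpp u)
  | ?a *: ?x => let u := vec_reify x env in open_constr:(VScale a u)
  | _ => let n := vec_index t env in open_constr:(VAtom n)
  end.

Ltac vec_coefs :=
  lazymatch goal with
  | |- @eq ?V ?x ?y =>
      let env := vec_atoms x (@nil V) in
      let env := vec_atoms y env in
      let u := vec_reify x env in
      let v := vec_reify y env in
      change (veval env u = veval env v);
      apply: veval_eq; [by [] | rewrite /=; repeat (split => //)]
  end.

Ltac vec := vec_coefs; ring.
Ltac vfield := vec_coefs; field.

(** * Convexity of the norm *)

Section Norm.
Context {R : realType} {V : normedModType R}.
Implicit Types (x y z v k : V) (a b r s t : R).

Lemma normD_le x y z : x = y + z -> `|x| <= `|y| + `|z|.
Proof. by move=> ->; exact: ler_normD. Qed.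

Lemma normZ_ge0 a x : 0 <= a -> `|a *: x| = a * `|x|.
Proof. by move=> a0; rewrite normrZ ger0_norm. Qed.

Lemma openP (G : set V) :
  open G <-> forall z, G z -> exists2 r, 0 < r & forall x, `|x - z| < r -> G x.
Proof.
rewrite openE; split=> [oG z /oG /nbhs_ballP[r /= r0 zrG]|oG z /oG[r r0 zrG]].
  by exists r => // x xz; apply: zrG; rewrite -ball_normE /= distrC.
by apply/nbhs_ballP; exists r => // x; rewrite -ball_normE /= distrC => /zrG.
Qed.

(** Additivity for one pair of positive coefficients forces the norm to be
    linear on the whole cone spanned by x and y: subtracting the excess multiple
    of y from a (x + y) loses at most its norm. *)
Lemma norm_additive x y a b : 0 <= a -> 0 <= b -> `|x + y| = `|x| + `|y| ->
  `|a *: x + b *: y| = a * `|x| + b * `|y|.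
Proof.
wlog le_ba : x y a b / b <= a.
  move=> W a0 b0 xy; have [/W|/ltW /W] := leP b a; first by apply.
  by rewrite addrC [RHS]addrC; apply => //; rewrite addrC xy addrC.
move=> a0 b0 xy; apply/eqP; rewrite eq_le; apply/andP; split.
  by rewrite (le_trans (ler_normD _ _)) // !normZ_ge0.
have: `|a *: (x + y)| <= `|a *: x + b *: y| + `|(a - b) *: y|.
  by apply: normD_le; vec.
by rewrite !normZ_ge0 ?subr_ge0 // xy; lra.
Qed.

Lemma norm_additive_split v x y :
  `|v + (x + y)| = `|v| + (`|x| + `|y|) -> `|v + x| = `|v| + `|x|.
Proof.
move=> vxy; have: `|v + (x + y)| <= `|v + x| + `|y| by apply: normD_le; vec.
by have := ler_normD v x; lra.
Qed.

Lemma norm_convex x y s t : 0 <= s -> 0 <= t -> s + t = 1 ->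
  `|s *: x + t *: y| <= s * `|x| + t * `|y|.
Proof. by move=> *; rewrite (le_trans (ler_normD _ _)) // !normZ_ge0. Qed.

(** A convex function with equal values at 0 and a is at least that value
    outside the interval between them. *)
Lemma norm_min_of_flat_chord z k a s : 0 < a -> `|z + a *: k| = `|z| ->
  (s <= 0) || (a <= s) -> `|z| <= `|z + s *: k|.
Proof.
move=> a0 eqz /orP[s0|les].
  have: `|a *: (z + s *: k) + (- s) *: (z + a *: k)| <=
      a * `|z + s *: k| + (- s) * `|z|.
    rewrite (le_trans (ler_normD _ _)) // !normZ_ge0 ?oppr_ge0 ?(ltW a0) //.
    by rewrite eqz.
  rewrite (_ : _ + _ = (a - s) *: z); last by vec.
  rewrite normZ_ge0; last by lra.
  by rewrite mulrBl lerBlDr mulNr subrK ler_pM2l.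
have: `|s *: (z + a *: k)| <= `|(s - a) *: z| + `|a *: (z + s *: k)|.
  by apply: normD_le; vec.
rewrite !normZ_ge0; [|lra|lra|lra]; rewrite eqz mulrBl => H.
by rewrite -(ler_pM2l a0); lra.
Qed.

Lemma norm_local_min z k r : 0 < r ->
    (forall s, `|s| < r -> `|z| <= `|z + s *: k|) ->
  forall s, `|z| <= `|z + s *: k|.
Proof.
move=> r0 lmin s.
pose t := r / (r + `|s|).
have rs0 : 0 < r + `|s| by rewrite ltr_pwDl.
have t0 : 0 < t by rewrite divr_gt0.
have t1 : t <= 1 by rewrite ler_pdivrMr // mul1r lerDl.
have := lmin (t * s).
rewrite normrM (ger0_norm (ltW t0)) /t mulrAC ltr_pdivrMr // -/t.
rewrite ltr_pM2l // ltrDr r0 => /(_ isT).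
have : `|(1 - t) *: z + t *: (z + s *: k)| <= (1 - t) * `|z| + t * `|z + s *: k|.
  by apply: norm_convex => //; lra.
rewrite (_ : (1 - t) *: z + _ = z + (t * s) *: k); last by vec.
move=> H1 H2; rewrite -(ler_pM2l t0); lra.
Qed.

End Norm.

(** * Flat directions *)

Section Cylinder.
Context {R : realType} {X : normedModType R}.
Hypothesis nocone : ~ fixed_direction_cylindrical_open_cone X.

(** The two inequalities obtained at the endpoints of a segment parallel to k
    make the norm constant on it, so k spans a cylinder direction of G. The
    one-sided hypothesis is the one that survives limits. *)
Lemma flat_direction_eq0 (G : set X) (k : X) : open_cone G -> ~ G 0 ->
    G !=set0 ->
    (forall z (s : R), G z -> `|z| <= `|z + s *: k|) ->
  k = 0.
Proof.
move=> cG G0 neG flat; apply/eqP/negPn/negP => k0; apply: nocone.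
exists k, G; split=> // z t [_ segG].
have Gz : G z.
  apply/segG/subset_closure; exists 0; rewrite /= ?in_itv /= ?lexx ?ler01 //.
  by vec.
have Gzt : G (z + t *: k).
  apply/segG/subset_closure; exists 1; rewrite /= ?in_itv /= ?lexx ?ler01 //.
  by vec.
apply/eqP; rewrite eq_le flat // andbT.
have := flat _ (- t) Gzt; by rewrite (_ : z + t *: k + _ = z) //; vec.
Qed.

Lemma locally_flat_direction_eq0 (G : set X) (k : X) : open_cone G -> ~ G 0 ->
    G !=set0 ->
    (forall z, G z -> exists2 r : R, 0 < r &
       forall s, `|s| < r -> `|z| <= `|z + s *: k|) ->
  k = 0.
Proof.
move=> cG G0 neG flat; apply: (@flat_direction_eq0 G) => // z s /flat[r r0].
by move/norm_local_min; exact.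
Qed.

End Cylinder.

(** * Finite-dimensional normed spaces *)

Section FiniteDimension.
Context {R : realType}.

Definition comb (V : lmodType R) n (v : 'I_n -> V) (a : 'rV[R]_n) : V :=
  \sum_i a 0 i *: v i.

Fact comb_is_linear (V : lmodType R) n (v : 'I_n -> V) : linear (comb v).
Proof.
move=> k a b; rewrite /comb scaler_sumr -big_split; apply: eq_bigr => i _.
by rewrite !mxE scalerDl scalerA.
Qed.

HB.instance Definition _ (V : lmodType R) n (v : 'I_n -> V) :=
  GRing.isLinear.Build R 'rV[R]_n V _ (comb v) (comb_is_linear v).

Definition independent (V : lmodType R) n (v : 'I_n -> V) :=
  forall a, comb v a = 0 -> a = 0.

Lemma norm_coord_le n (a : 'rV[R]_n) i : `|a 0 i| <= `|a|.
Proof.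
rewrite [leRHS]/Num.norm /= mx_normrE; apply/bigmax_geP; right => /=.
by exists (0, i).
Qed.

Lemma norm_comb_le (V : normedModType R) n (v : 'I_n -> V) a :
  `|comb v a| <= `|a| * \sum_i `|v i|.
Proof.
rewrite (le_trans (ler_norm_sum _ _ _)) // mulr_sumr ler_sum // => i _.
by rewrite normrZ ler_wpM2r // norm_coord_le.
Qed.

Lemma comb_continuous (V : normedModType R) n (v : 'I_n -> V) :
  continuous (comb v : 'rV[R]_n -> V).
Proof.
apply/linear_bounded_continuous/linear_boundedP.
exists (\sum_i `|v i|); split=> [|r /ltW le_r a]; first exact: num_real.
by rewrite mulrC (le_trans (norm_comb_le v a)) // ler_wpM2l.
Qed.

(** The norm of a combination attains a positive minimum on the unit sphere of
    the coordinate space. *)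
Lemma independent_bounded_below (V : normedModType R) n (v : 'I_n -> V) :
  independent v ->
  exists2 c : R, 0 < c & forall a, c * `|a| <= `|comb v a|.
Proof.
move=> indep_v; pose S := [set a : 'rV[R]_n | `|a| = 1].
have [S0|/set0P neS] := eqVneq S set0.
  exists 1 => // a; have [->|a0] := eqVneq a 0; first by rewrite normr0 mulr0.
  have : S (`|a|^-1 *: a).
    by rewrite /S /= normrZ normfV normr_id mulVf ?normr_eq0.
  by rewrite S0.
have cS : compact S.
  apply: bounded_closed_compact.
    exists 1; split; first exact: num_real.
    by move=> x lt1x a /= ->; exact: ltW.
  rewrite (_ : S = Num.norm @^-1` [set (1 : R)]) //.
  by apply: closed_comp (@closed_eq _ 1) => a _; apply: norm_continuous.
have cont : {within S, continuous (fun a => `|comb v a| : R)}.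
  apply: continuous_subspaceT => a.
  apply: (continuous_comp (@comb_continuous _ _ v a)); exact: norm_continuous.
have [a /set_mem Sa mina] := compact_EVT_min neS cS cont.
have a0 : a != 0 by rewrite -normr_eq0 Sa oner_eq0.
exists `|comb v a|.
  by rewrite normr_gt0; apply: contra_neq a0; exact: indep_v.
move=> b; have [->|b0] := eqVneq b 0; first by rewrite normr0 mulr0.
have nb0 : `|b| != 0 by rewrite normr_eq0.
have /mina : (`|b|^-1 *: b) \in S.
  by apply/mem_set; rewrite /S /= normrZ normfV normr_id mulVf.
rewrite linearZ /= normrZ normfV normr_id mulrC.
by rewrite -ler_pdivlMr ?invr_gt0 ?normr_gt0 // invrK.
Qed.

Lemma independent3 (V : lmodType R) (x y z : V) :
    x <> 0 -> (forall a, y <> a *: x) -> (forall a b, z <> a *: x + b *: y) ->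
  independent (fun i : 'I_3 => [:: x; y; z]`_i).
Proof.
move=> x0 yx zxy a; rewrite /comb !big_ord_recl big_ord0 /= addr0 => a_eq.
set a0 := a 0 _ in a_eq; set a1 := a 0 _ in a_eq; set a2 := a 0 _ in a_eq.
have a20 : a2 = 0.
  apply/eqP/negPn/negP => n0; apply: (zxy (- a0 / a2) (- a1 / a2)).
  apply: (scalerI n0); apply/eqP; rewrite -subr_eq0 -a_eq; apply/eqP.
  by vfield.
have a10 : a1 = 0.
  apply/eqP/negPn/negP => n0; apply: (yx (- a0 / a1)).
  apply: (scalerI n0); apply/eqP; rewrite -subr_eq0 -a_eq a20; apply/eqP.
  by vfield.
have a00 : a0 = 0.
  apply/eqP/negPn/negP => n0; apply: x0.
  by apply: (scalerI n0); rewrite scaler0 -a_eq a20 a10; vec.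
apply/rowP => i; rewrite !mxE; case: i => [[|[|[|//]]] lt_i].
- by rewrite -[RHS]a00; congr (a _ _); apply/val_inj.
- by rewrite -[RHS]a10; congr (a _ _); apply/val_inj.
- by rewrite -[RHS]a20; congr (a _ _); apply/val_inj.
Qed.

Section Dimension3.
Context {X : normedModType R}.
Hypothesis dimX : Vector.axiom 3 X.

Lemma coordinates : exists c : {linear X -> 'rV[R]_3}, bijective c.
Proof.
case: dimX => f linf bij_f.
by exists (HB.pack_for {linear X -> 'rV[R]_3} f
  (GRing.isLinear.Build R X 'rV[R]_3 _ f linf)).
Qed.

Lemma independent_coordinates (v : 'I_3 -> X) : independent v ->
  exists c : {linear X -> 'rV[R]_3}, cancel c (comb v) /\ cancel (comb v) c.
Proof.
case: coordinates => c /bij_inj cI indep_v.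
pose M : 'M[R]_3 := \matrix_i c (v i).
have combM a : c (comb v a) = a *m M.
  rewrite linear_sum mulmx_sum_row; apply: eq_bigr => i _.
  by rewrite linearZ rowK.
have Mu : M \in unitmx.
  rewrite -row_free_unit; apply: inj_row_free => a aM; apply: indep_v; apply: cI.
  by rewrite combM aM linear0.
exists (mulmxr (invmx M) \o c)%FUN; split=> [x|a] /=.
  by apply: cI; rewrite combM mulmxKV.
by rewrite combM mulmxK.
Qed.

Lemma linear_extension (Y : lmodType R) (v : 'I_3 -> X) (w : 'I_3 -> Y) :
  independent v -> exists T : {linear X -> Y}, forall i, T (v i) = w i.
Proof.
move=> /independent_coordinates[c [_ vK]].
exists (comb w \o c)%FUN => i /=.
have combE (V : lmodType R) (u : 'I_3 -> V) : u i = comb u (delta_mx 0 i).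
  rewrite /comb (bigD1 i) //= mxE !eqxx scale1r big1 ?addr0 // => j /negbTE ji.
  by rewrite mxE ji andbF scale0r.
by rewrite [v i]combE vK -combE.
Qed.

Lemma triple_coordinates (x y z : X) :
    independent (fun i : 'I_3 => [:: x; y; z]`_i) ->
  exists2 C : R, 0 < C & forall w, exists a b c, w = a *: x + b *: y + c *: z /\
    [/\ `|a| <= C * `|w|, `|b| <= C * `|w| & `|c| <= C * `|w| ].
Proof.
move=> indep; have [k k0 kP] := independent_bounded_below indep.
have [cd [cdK _]] := independent_coordinates indep.
exists k^-1 => [|w]; first by rewrite invr_gt0.
have bound i : `|cd w 0 i| <= k^-1 * `|w|.
  rewrite (le_trans (norm_coord_le _ _)) // ler_pdivlMl //.
  by rewrite -[X in _ <= `|X|]cdK kP.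
exists (cd w 0 ord0), (cd w 0 (lift ord0 ord0)),
  (cd w 0 (lift ord0 (lift ord0 ord0))); split=> //.
by rewrite -[LHS]cdK /comb !big_ord_recl big_ord0 /= addr0 addrA.
Qed.

Definition simplicial_cone (x y z : X) : set X :=
  [set w | exists a b c : R,
     [/\ 0 < a, 0 < b, 0 < c & w = a *: x + b *: y + c *: z]].

Lemma simplicial_cone_open_cone (x y z : X) :
    independent (fun i : 'I_3 => [:: x; y; z]`_i) ->
  open_cone (simplicial_cone x y z).
Proof.
move=> /triple_coordinates[C C0 coords].
split=> [|k _ k0 [a [b [c [a0 b0 c0 ->]]]]]; last first.
  by exists (k * a), (k * b), (k * c); rewrite !mulr_gt0 //; split=> //; vec.
apply/openP => _ [a [b [c [a0 b0 c0 ->]]]].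
pose m := Num.min a (Num.min b c).
have m0 : 0 < m by rewrite !lt_min a0 b0.
have [ma mb mc] : [/\ m <= a, m <= b & m <= c].
  by rewrite /m !ge_min !lexx !orbT.
exists (m / C) => [|w]; first exact: divr_gt0.
have [a' [b' [c' [wE [a'C b'C c'C]]]]] := coords (w - (a *: x + b *: y + c *: z)).
rewrite ltr_pdivlMr // mulrC => lt_m.
move: (le_lt_trans a'C lt_m) (le_lt_trans b'C lt_m) (le_lt_trans c'C lt_m).
rewrite !ltr_norml => /andP[a1 _] /andP[b1 _] /andP[c1 _].
exists (a + a'), (b + b'), (c + c'); split; [lra | lra | lra |].
by rewrite -[LHS](subrK (a *: x + b *: y + c *: z)) wE; vec.
Qed.

(** If an open set were contained in the span of x and y, this span would be
    the whole space, which has dimension three. *)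
Lemma open_off_plane (G : set X) (x y : X) : open G -> G !=set0 ->
  exists2 z, G z & forall a b, z <> a *: x + b *: y.
Proof.
move=> /openP oG [z0 Gz0]; apply/not_exists2P => inplane.
have {}inplane z : G z -> exists a b, z = a *: x + b *: y.
  move=> Gz; have [//|] := inplane z.
  by move=> /existsNP[a /existsNP[b /contrapT ->]]; exists a, b.
have [r r0 zG] := oG _ Gz0.
have span u : exists a b, u = a *: x + b *: y.
  have [->|u0] := eqVneq u 0; first by exists 0, 0; vec.
  have nu0 : 0 < `|u| by rewrite normr_gt0.
  pose t := r / 2 / `|u|.
  have t0 : t != 0 by rewrite gt_eqF // !divr_gt0.
  have [a [b z0E]] := inplane _ Gz0.
  have [|a' [b' zE]] := inplane (z0 + t *: u).
    apply: zG; rewrite (_ : z0 + t *: u - z0 = t *: u); last by vec.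
    rewrite normrZ gtr0_norm ?divr_gt0 // ?divr_gt0 //.
    by rewrite /t divfK ?gt_eqF // ltr_pdivrMr // ltr_pMr // ltr1n.
  exists (t^-1 * (a' - a)), (t^-1 * (b' - b)).
  apply: (scalerI t0).
  rewrite (_ : t *: u = (z0 + t *: u) - z0); last by vec.
  by rewrite zE z0E; vfield.
case: coordinates => c [g _ gK].
pose B : 'M[R]_(1 + 1, 3) := col_mx (c x) (c y).
have : (1%:M <= B)%MS.
  apply/row_subP => i; have [p [q E]] := span (g (row i 1%:M)).
  rewrite -[row i _]gK E linearD !linearZ /=.
  apply: addmx_sub; apply: scalemx_sub.
    by apply: submx_trans (_ : B <= B)%MS => //; rewrite -addsmxE addsmxSl.
  by rewrite -addsmxE addsmxSr.
move=> /mxrankS; rewrite mxrank1 => /leq_trans/(_ (rank_leq_row B)).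
by [].
Qed.

Lemma independent_in_open (G : set X) : open G -> G !=set0 ->
  exists x y z, [/\ G x, G y, G z &
    independent (fun i : 'I_3 => [:: x; y; z]`_i)].
Proof.
move=> oG neG.
have [x Gx x0] := open_off_plane 0 0 oG neG.
have [y Gy yx] := open_off_plane x 0 oG neG.
have [z Gz zxy] := open_off_plane x y oG neG.
exists x, y, z; split=> //; apply: independent3 => //.
  by move=> x00; apply: (x0 0 0); rewrite x00; vec.
by move=> a y_ax; apply: (yx a 0); rewrite y_ax; vec.
Qed.

(** Bolzano-Weierstrass; it is the form of compactness used below. *)
Lemma bounded_seq_cluster (u : nat -> X) (M : R) : (forall n, `|u n| <= M) ->
  exists l, forall e, 0 < e -> forall N, exists2 n, (N <= n)%N & `|u n - l| < e.
Proof.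
move=> uM.
have [x [y [z [_ _ _]]]] :=
  independent_in_open openT (ex_intro [set: X] 0 I).
set v := fun i => _ => indep_v.
have [c c0 vc] := independent_bounded_below indep_v.
have [cd [cdK _]] := independent_coordinates indep_v.
pose a n := cd (u n); have aE n : u n = comb v (a n) by rewrite cdK.
pose B := [set b : 'rV[R]_3 | `|b| <= M / c].
have cB : compact B.
  apply: bounded_closed_compact.
    exists (M / c); split=> [|r /ltW lt_r b /= /le_trans]; last exact.
    exact: num_real.
  rewrite (_ : B = Num.norm @^-1` [set r : R | r <= M / c]) //.
  by apply: closed_comp (@closed_le _ _) => b _; apply: norm_continuous.
have Ba : (a @ \oo) B.
  exists 0%N => // n _; rewrite /B /= ler_pdivlMr // mulrC.
  by rewrite (le_trans (vc _)) // -aE.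
have [b [_ clb]] := cB (a @ \oo) _ Ba.
exists (comb v b) => e e0 N.
pose K := 1 + \sum_i `|v i|.
have K0 : 0 < K by rewrite ltr_pwDl // sumr_ge0.
have aN : (a @ \oo) [set b | exists2 n, (N <= n)%N & b = a n].
  by exists N => // n /= Nn; exists n.
have eK : 0 < e / K by rewrite divr_gt0.
have [_ [[n Nn ->]]] := clb _ _ aN (nbhsx_ballx b _ eK).
rewrite -ball_normE /= distrC => ban; exists n => //.
rewrite aE -linearB (le_lt_trans (norm_comb_le _ _)) //.
apply: le_lt_trans (_ : `|a n - b| * K < e); last by rewrite -ltr_pdivlMr.
by rewrite ler_wpM2l // lerDr.
Qed.

Lemma linear_bounded (Y : normedModType R) (T : {linear X -> Y}) :
  exists2 C : R, 0 < C & forall x, `|T x| <= C * `|x|.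
Proof.
have [x [y [z [_ _ _ indep]]]] :=
  independent_in_open openT (ex_intro [set: X] 0 I).
have [C C0 coords] := triple_coordinates indep.
pose S := 1 + `|T x| + `|T y| + `|T z|.
have S0 : 0 < S by rewrite !ltr_wpDr.
exists (C * S) => [|w]; first exact: mulr_gt0.
have [a [b [c [wE [aw bw cw]]]]] := coords w.
have CS v : C * `|w| * `|T v| = C * `|T v| * `|w| by ring.
rewrite {1}wE !linearD !linearZ /= /S mulrAC !mulrDr mulr1.
rewrite (le_trans (ler_normD _ _)) // lerD ?normrZ ?ler_wpM2r //.
rewrite (le_trans (ler_normD _ _)) // !normrZ lerD ?ler_wpM2r //.
by rewrite ler_wpDl ?ler_wpM2r // mulr_ge0 // ltW.
Qed.

Lemma injective_bounded_below (Y : normedModType R) (T : {linear X -> Y}) :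
  injective T -> exists2 C : R, 0 < C & forall x, `|x| <= C * `|T x|.
Proof.
move=> injT.
have [x [y [z [_ _ _]]]] := independent_in_open openT (ex_intro [set: X] 0 I).
set v := fun i => _ => indep.
have Tcomb a : T (comb v a) = comb (T \o v) a.
  by rewrite linear_sum; apply: eq_bigr => i _; rewrite linearZ.
have indepT : independent (T \o v).
  by move=> a; rewrite -Tcomb -[0](linear0 T) => /injT; exact: indep.
have [c c0 cP] := independent_bounded_below indepT.
have [cd [cdK _]] := independent_coordinates indep.
pose K := 1 + \sum_i `|v i|.
have K0 : 0 < K by rewrite ltr_pwDl // sumr_ge0.
exists (K / c) => [|w]; first exact: divr_gt0.
rewrite -[w]cdK Tcomb (le_trans (norm_comb_le _ _)) //.
rewrite mulrC -mulrA ler_pM ?sumr_ge0 ?lerDr //.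
by rewrite ler_pdivlMl.
Qed.

End Dimension3.
End FiniteDimension.

(** * Homogeneous extensions of sphere isometries *)

Section SphericalIsometry.
Context {R : realType} {X Y : normedModType R}.

(** The positively homogeneous extensions of surjective isometries between unit
    spheres. Distances are preserved only between vectors of equal norm. *)
Record spherical_isometry (F : X -> Y) : Prop := SphericalIsometry {
  sph_homog : forall a x, 0 <= a -> F (a *: x) = a *: F x;
  sph_norm : forall x, `|F x| = `|x|;
  sph_dist : forall x y, `|x| = `|y| -> `|F x - F y| = `|x - y|;
  sph_surj : forall y, exists x, F x = y }.

Definition radial_extension (f : X -> Y) (x : X) : Y :=
  `|x| *: f (`|x|^-1 *: x).

Lemma radial_extensionE f x : `|x| = 1 -> radial_extension f x = f x.
Proof. by move=> x1; rewrite /radial_extension x1 invr1 !scale1r. Qed.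

Lemma unit_normalize (V : normedModType R) (x : V) : x != 0 ->
  `| `|x|^-1 *: x| = 1.
Proof. by move=> x0; rewrite normrZ normfV normr_id mulVf ?normr_eq0. Qed.

Lemma normalizeK (V : normedModType R) (x : V) : x != 0 ->
  `|x| *: (`|x|^-1 *: x) = x.
Proof. by move=> x0; rewrite scalerA mulfV ?normr_eq0 // scale1r. Qed.

Lemma radial_extension_isometry (f : X -> Y) :
    set_fun (@unit_sphere R X) (@unit_sphere R Y) f ->
    set_surj (@unit_sphere R X) (@unit_sphere R Y) f ->
    isometry_on (@unit_sphere R X) f ->
  spherical_isometry (radial_extension f).
Proof.
move=> f_fun f_surj f_iso.
have normF x : `|radial_extension f x| = `|x|.
  have [->|x0] := eqVneq x 0; last first.
    rewrite normrZ normr_id (_ : `|f _| = 1) ?mulr1 //.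
    by apply: f_fun; exact: unit_normalize.
  by rewrite /radial_extension normr0 scale0r normr0.
split=> // [a x|x y xy|y].
- rewrite le_eqVlt => /predU1P[<-|a0].
    by rewrite /radial_extension !scale0r normr0 scale0r.
  rewrite /radial_extension normrZ gtr0_norm // -scalerA; congr (_ *: _).
  have [->|x0] := eqVneq x 0; first by rewrite normr0 !scale0r.
  congr (_ *: f _); rewrite scalerA; congr (_ *: _).
  by rewrite invfM mulrAC mulVf ?mul1r // gt_eqF.
- have [y0|y0] := eqVneq y 0.
    move: xy; rewrite y0 normr0 => /eqP; rewrite normr_eq0 => /eqP ->.
    by rewrite !subrr !normr0.
  have x0 : x != 0 by rewrite -normr_eq0 xy normr_eq0.
  rewrite /radial_extension xy -scalerBr normrZ normr_id f_iso.
  + rewrite -scalerBr normrZ normfV normr_id mulrA mulfV ?mul1r //.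
    by rewrite normr_eq0.
  + by rewrite /unit_sphere /= -xy unit_normalize.
  + by rewrite /unit_sphere /= unit_normalize.
- have [->|y0] := eqVneq y 0.
    by exists 0; rewrite /radial_extension normr0 scale0r.
  have [x x1 fx] := f_surj _ (unit_normalize y0).
  exists (`|y| *: x); rewrite /radial_extension normrZ normr_id x1 mulr1.
  by rewrite scalerA mulVf ?normr_eq0 // scale1r fx normalizeK.
Qed.

Section Theory.
Variables (F : X -> Y) (isoF : spherical_isometry F).

Lemma sph0 : F 0 = 0.
Proof. by apply/eqP; rewrite -normr_eq0 (sph_norm isoF) normr0. Qed.

Lemma sph_inj : injective F.
Proof.
move=> x y Fxy; apply/eqP; rewrite -subr_eq0 -normr_eq0 -(sph_dist isoF).
  by rewrite Fxy subrr normr0.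
by rewrite -(sph_norm isoF) Fxy (sph_norm isoF).
Qed.

Lemma sph_opp : spherical_isometry (fun x => - F (- x)).
Proof.
split=> [a x a0|x|x y xy|y].
- by rewrite -scalerN (sph_homog isoF) // scalerN.
- by rewrite normrN (sph_norm isoF) normrN.
- rewrite -opprD normrN (sph_dist isoF) ?normrN // -opprD normrN //.
- by have [x Fx] := sph_surj isoF (- y); exists (- x); rewrite opprK Fx opprK.
Qed.

(** In terms of the companion isometry of [sph_opp], a sum can be measured as
    well as a difference. *)
Lemma sph_dist_opp x y : `|x| = `|y| -> `|F x - F (- y)| = `|x + y|.
Proof. by move=> xy; rewrite (sph_dist isoF) ?normrN // opprK. Qed.

(** Compare y with its rescaling a y to the norm of x: the isometry condition
    controls x and a y, homogeneity controls a y and y. *)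
Lemma sph_lipschitz x y : `|F x - F y| <= 3 * `|x - y|.
Proof.
have [->|y0] := eqVneq y 0.
  by rewrite sph0 !subr0 (sph_norm isoF); have := normr_ge0 x; lra.
pose a := `|x| / `|y|; have a0 : 0 <= a by rewrite divr_ge0.
have ay : a * `|y| = `|x| by rewrite divfK ?normr_eq0.
have nxy := lerB_dist x y; have nyx := lerB_dist y x; rewrite distrC in nyx.
have E (V : normedModType R) (v : V) : `|v| = `|y| -> `|a *: v - v| <= `|x - y|.
  move=> vy; rewrite (_ : _ - _ = (a - 1) *: v); last by vec.
  rewrite normrZ vy -[`|y| in X in X <= _]normr_id -normrM mulrBl mul1r ay.
  by rewrite ler_norml; lra.
have Fxay : `|F x - a *: F y| = `|x - a *: y|.
  by rewrite -(sph_homog isoF) // (sph_dist isoF) // normZ_ge0.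
have := @normD_le _ _ (x - a *: y) (x - y) (y - a *: y).
have := @normD_le _ _ (F x - F y) (F x - a *: F y) (a *: F y - F y).
have := E _ _ (sph_norm isoF y); have := E _ _ (erefl `|y|).
rewrite [`|y - _|]distrC => ? ? /(_ ltac:(vec)) ? /(_ ltac:(vec)).
lra.
Qed.

End Theory.
End SphericalIsometry.

Section Inverse.
Context {R : realType} {X Y : normedModType R}.
Variables (F : X -> Y) (isoF : spherical_isometry F).

Lemma sph_inverse : exists2 G : Y -> X, spherical_isometry G & cancel F G.
Proof.
have /choice[G GK] := sph_surj isoF.
have FK : cancel F G by move=> x; apply: (sph_inj isoF); rewrite GK.
have normG y : `|G y| = `|y| by rewrite -(sph_norm isoF) GK.
exists G => //; split=> // [a y a0|x y xy|x]; last by exists (F x).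
  by apply: (sph_inj isoF); rewrite GK (sph_homog isoF) // GK.
by rewrite -(sph_dist isoF) ?GK // !normG.
Qed.

Lemma sph_colipschitz x y : `|x - y| <= 3 * `|F x - F y|.
Proof.
have [G isoG FK] := sph_inverse.
by rewrite -{1}[x]FK -{1}[y]FK sph_lipschitz.
Qed.

Lemma sph_open (G : set X) : open G -> open (F @` G).
Proof.
move=> /openP oG; apply/openP => _ [z Gz <-].
have [r r0 zG] := oG _ Gz; exists (r / 3) => [|y]; first by rewrite divr_gt0.
have [x <-] := sph_surj isoF y => yz; exists x => //.
by apply: zG; have := sph_colipschitz x z; lra.
Qed.

End Inverse.

(** * The cone over a star with interior *)

Section ApexCone.
Context {R : realType} {X : normedModType R}.
Variable e : X.
Hypothesis norm_e : `|e| = 1.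

(** The interior of the cone over the star of e. Taking all t >= 0 makes it
    stable under translation by nonnegative multiples of e. *)
Definition apex_cone : set X :=
  [set z | forall t : R, 0 <= t -> `|z + t *: e| = `|z| + t]°.

Lemma apex_coneP z : apex_cone z <-> exists2 r : R, 0 < r &
  forall x, `|x - z| < r -> forall t : R, 0 <= t -> `|x + t *: e| = `|x| + t.
Proof.
split=> [/nbhs_ballP[r /= r0 zr]|[r r0 zr]].
  by exists r => // x xz; apply: zr; rewrite -ball_normE /= distrC.
by apply/nbhs_ballP; exists r => // x; rewrite -ball_normE /= distrC => /zr.
Qed.

Lemma apex_cone_norm z (t : R) : apex_cone z -> 0 <= t ->
  `|z + t *: e| = `|z| + t.
Proof. by move=> /interior_subset; exact. Qed.

Lemma apex_cone_open : open apex_cone.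
Proof. exact: open_interior. Qed.

Lemma apex_cone_shift z (t : R) : apex_cone z -> 0 <= t ->
  apex_cone (z + t *: e).
Proof.
move=> /apex_coneP[r r0 zr] t0; apply/apex_coneP; exists r => // x xz s s0.
have x'z : `|(x - t *: e) - z| < r.
  by rewrite (_ : _ - z = x - (z + t *: e)) //; vec.
have xE u : x + u *: e = (x - t *: e) + (u + t) *: e by vec.
have := zr _ x'z (0 + t); have := zr _ x'z (s + t).
rewrite -!xE (_ : x + 0 *: e = x); last by vec.
by move=> /(_ ltac:(lra)) -> /(_ ltac:(lra)) ->; lra.
Qed.

Lemma apex_cone_cone : open_cone apex_cone.
Proof.
split=> [|a z a0 /apex_coneP[r r0 zr]]; first exact: apex_cone_open.
apply/apex_coneP; exists (a * r) => [|x xz t t0]; first exact: mulr_gt0.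
have xE : x = a *: (a^-1 *: x) by rewrite scalerA mulfV ?gt_eqF // scale1r.
have /zr/(_ (a^-1 * t)) : `|a^-1 *: x - z| < r.
  rewrite -(ltr_pM2l a0) -[a in a * _](gtr0_norm a0) -normrZ.
  by rewrite scalerBr -xE.
rewrite mulr_ge0 // ?invr_ge0 ?(ltW a0) // => /(_ isT) H.
rewrite (_ : x + t *: e = a *: (a^-1 *: x + (a^-1 * t) *: e)).
  rewrite normZ_ge0 ?(ltW a0) // H mulrDr -(normZ_ge0 _ (ltW a0)) -xE.
  by rewrite mulrA mulfV ?gt_eqF // mul1r.
by rewrite scalerDr -xE scalerA mulrA mulfV ?gt_eqF // mul1r.
Qed.

Lemma apex_cone0 : ~ apex_cone 0.
Proof.
move=> /apex_coneP[r r0 /(_ (- (r / 2) *: e))].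
have r2 : 0 <= r / 2 by lra.
rewrite subr0 scaleNr normrN normZ_ge0 // norm_e => /(_ ltac:(lra) _ r2).
by rewrite addNr normr0; lra.
Qed.

Lemma apex_cone_neq0 z : apex_cone z -> z != 0.
Proof. by move=> Gz; apply/eqP => z0; apply: apex_cone0; rewrite -z0. Qed.

Lemma apex_cone_additive z : apex_cone z -> `|z + e| = `|z| + 1.
Proof. by move=> /apex_cone_norm/(_ ler01); rewrite scale1r. Qed.

Lemma apex_cone_nonempty :
  relative_interior (@unit_sphere R X) (star e) !=set0 -> apex_cone !=set0.
Proof.
move=> [u0 intu0]; exists u0.
have Su0 : unit_sphere u0.
  have [] // : star e u0.
  exact: (@interior_subset (subspace (@unit_sphere R X)) (star e)) intu0.
move: intu0; rewrite /relative_interior /interior /= /nbhs /=.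
rewrite -nbhs_subspace_in // => /nbhs_ballP[r /= r0 ur].
apply/apex_coneP; exists (Num.min (r / 2) 1) => [|z].
  by rewrite lt_min ltr01 divr_gt0.
rewrite lt_min => /andP[zu zu1] t t0.
have nu0 : `|u0| = 1 := Su0.
have n1 := lerB_dist u0 z; have n2 := lerB_dist z u0.
rewrite [`|u0 - z|]distrC nu0 in n1; rewrite nu0 in n2.
have z0 : z != 0 by rewrite -normr_gt0; lra.
have : star e (`|z|^-1 *: z).
  apply: ur; last by rewrite /= /unit_sphere /= unit_normalize.
  rewrite -ball_normE /= distrC.
  have -> : `|z|^-1 *: z - u0 = (`|z|^-1 - 1) *: z + (z - u0) by vec.
  apply: le_lt_trans (ler_normD _ _) _.
  have -> : `|(`|z|^-1 - 1) *: z| = `|1 - `|z| |.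
    by rewrite normrZ -[X in _ * X]normr_id -normrM mulrBl mul1r mulVf ?normr_eq0.
  have : `|1 - `|z| | <= `|z - u0| by rewrite ler_norml; lra.
  by lra.
case=> _ H.
have : `|t *: e + `|z| *: (`|z|^-1 *: z)| = t * `|e| + `|z| * `| `|z|^-1 *: z|.
  by apply: norm_additive => //; rewrite H unit_normalize // norm_e.
by rewrite normalizeK // unit_normalize // norm_e addrC => ->; lra.
Qed.

Hypothesis dimX : Vector.axiom 3 X.
Hypothesis nocone : ~ fixed_direction_cylindrical_open_cone X.

(** Among the multiples of e, only e itself can be a unit vector of the cone:
    the vector - e is excluded because its sum with e vanishes. *)
Lemma apex_cone_indep u a : apex_cone u -> `|u| = 1 -> u <> e -> u <> a *: e.
Proof.
move=> Gu u1 ue uE; have := apex_cone_additive Gu.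
have : `|a| = 1 by rewrite -u1 uE normrZ norm_e mulr1.
have [a0|a0] := leP 0 a; [rewrite ger0_norm // | rewrite ltr0_norm //] => a1.
  by case: ue; rewrite uE a1 scale1r.
by rewrite u1 (_ : u + e = 0) ?normr0; [lra|rewrite uE (_ : a = - 1); [vec|lra]].
Qed.

Lemma apex_cone_unit_off x y : apex_cone !=set0 ->
  exists v, [/\ `|v| = 1, apex_cone v & forall a b, v <> a *: x + b *: y].
Proof.
move=> neG; have [v Gv v_off] := open_off_plane dimX x y apex_cone_open neG.
have v0 := apex_cone_neq0 Gv; exists (`|v|^-1 *: v); split.
- exact: unit_normalize.
- by apply: (apex_cone_cone.2); rewrite ?invr_gt0 ?normr_gt0.
- move=> a b vE; apply: (v_off (`|v| * a) (`|v| * b)).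
  by rewrite -[LHS](normalizeK v0) vE; vec.
Qed.

(** If y were off the plane of e and u, the norm would be linear on the cone
    spanned by e, u and u + (r / 2) y. Indeed u and y are additive because
    |u + y| = 2, the combination of u and u + (r / 2) y stays in the apex cone
    when r is small, and there e is additive with everything. Then e - u would
    be a flat direction. No differentiability of the norm at u is needed because
    the apex cone is open. *)
Lemma star_coplanar u y : apex_cone u -> `|u| = 1 -> u <> e ->
  `|y| = 1 -> `|u + y| = 2 -> exists a b, y = a *: e + b *: u.
Proof.
move=> Gu u1 ue y1 uy; apply: contrapT => offplane.
have e0 : e <> 0 by move=> e0; have := norm_e; rewrite e0 normr0; lra.
have [r r0 ur] := (openP _).1 apex_cone_open _ Gu.
have r2 : 0 < r / 2 by lra.
pose u' := u + (r / 2) *: y.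
have indep : independent (fun i : 'I_3 => [:: e; u; u']`_i).
  apply: independent3 => // [a|a b u'E]; first exact: apex_cone_indep.
  apply: offplane; exists ((r / 2)^-1 * a), ((r / 2)^-1 * (b - 1)).
  apply: (scalerI (lt0r_neq0 r2)); rewrite (_ : _ *: y = u' - u).
    by rewrite u'E; vfield; rewrite gt_eqF.
  by rewrite /u'; vec.
have norm_cone a b c : 0 < a -> 0 < b -> 0 < c ->
    `|a *: e + b *: u + c *: u'| = a + b + c * (1 + r / 2).
  move=> a0 b0 c0.
  have bc0 : 0 < b + c by lra.
  have t0 : 0 <= c / (b + c) * (r / 2) by rewrite mulr_ge0 ?divr_ge0 // ltW.
  have buc : b *: u + c *: u' = (b + c) *: (u + (c / (b + c) * (r / 2)) *: y).
    by rewrite /u'; vfield; rewrite gt_eqF.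
  have Gbuc : apex_cone (b *: u + c *: u').
    rewrite buc; apply: (apex_cone_cone.2) => //; apply: ur.
    rewrite addrC addKr normZ_ge0 // y1 mulr1.
    have : c / (b + c) <= 1 by rewrite ler_pdivrMr //; lra.
    by rewrite -(ler_pM2r r2); lra.
  have := apex_cone_norm Gbuc (ltW a0).
  rewrite {2}buc normZ_ge0 ?(ltW bc0) // -[u in X in _ * `|X| ]scale1r.
  rewrite norm_additive ?uy ?u1 ?y1 //.
  rewrite (_ : _ + a *: e = a *: e + b *: u + c *: u') => [->|]; last by vec.
  by field; rewrite gt_eqF.
apply: ue; apply/esym/eqP; rewrite -subr_eq0; apply/eqP.
apply: (locally_flat_direction_eq0 nocone (G := simplicial_cone e u u')).
- exact: simplicial_cone_open_cone.
- move=> [a [b [c [a0 b0 c0 z0]]]].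
  have := norm_cone _ _ _ a0 b0 c0; rewrite -z0 normr0.
  by have : 0 < c * (1 + r / 2) by [rewrite mulr_gt0 //; lra]; lra.
- by exists (1 *: e + 1 *: u + 1 *: u'), 1, 1, 1; do !split.
- move=> _ [a [b [c [a0 b0 c0 ->]]]].
  exists (Num.min a b); first by rewrite lt_min a0.
  move=> s; rewrite lt_min !ltr_norml => /andP[/andP[s1 s2] /andP[s3 s4]].
  rewrite (_ : _ + s *: (e - u) = (a + s) *: e + (b - s) *: u + c *: u').
    by rewrite !norm_cone //; lra.
  by vec.
Qed.

(** Coplanarity is first sharpened to the line through e and u by computing
    the norm of v + t w in two ways. If y lay on the opposite side of e, then e
    would be inside the segment from y to u; a unit vector v of the apex cone
    off the plane of e and u is additive with e, hence with u, so u would be on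
    the line through e and v. *)
Lemma star_ray u y : apex_cone u -> `|u| = 1 -> u <> e ->
  `|y| = 1 -> `|u + y| = 2 -> exists2 l : R, 0 <= l & y = e + l *: (u - e).
Proof.
move=> Gu u1 ue y1 uy.
have on_line v w : apex_cone v -> `|v| = 1 -> v <> e -> `|w| = 1 ->
    `|v + w| = 2 -> exists l : R, w = e + l *: (v - e).
  move=> Gv v1 ve w1 vw.
  have [a [b wE]] := star_coplanar Gv v1 ve w1 vw.
  suff ab : a + b = 1.
    by exists b; rewrite wE (_ : a = 1 - b); [vec|lra].
  have [r r0 vr] := (openP _).1 apex_cone_open _ Gv.
  (* t is so small that v + t w stays in the cone and 1 + t b is nonnegative. *)
pose t := Num.min (r / 2) (1 + `|b|)^-1.
  have b1 : 0 < 1 + `|b| by rewrite ltr_pwDl.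
  have t0 : 0 < t by rewrite lt_min invr_gt0 b1 divr_gt0.
  have tr : t < r by rewrite gt_min ltr_pdivrMr // ltr_pMr // ltr1n.
  have tb : 0 <= 1 + t * b.
    have : t * (1 + `|b|) <= 1 by rewrite -ler_pdivlMr // mul1r ge_min lexx orbT.
    have : t * - b <= t * `|b| by rewrite ler_pM2l // -normrN ler_norm.
    lra.
  have Gvw : apex_cone (v + t *: w).
    by apply: vr; rewrite addrC addKr normZ_ge0 ?ltW // w1 mulr1.
  have nvw : `|v + t *: w| = 1 + t.
    rewrite -[v in LHS]scale1r norm_additive ?(ltW t0) // ?vw ?v1 ?w1 //; lra.
  have [a0|a0] := leP 0 a.
    have : `|(1 + t * b) *: v + (t * a) *: e| = (1 + t * b) * `|v| + (t * a) * `|e|.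
      apply: norm_additive; rewrite // ?mulr_ge0 ?(ltW t0) //.
      by rewrite apex_cone_additive // norm_e.
    rewrite (_ : _ + (t * a) *: e = v + t *: w); last by rewrite wE; vec.
    rewrite nvw v1 norm_e => H; apply: (mulfI (lt0r_neq0 t0)); lra.
  have := apex_cone_norm Gvw (t := t * - a).
  rewrite mulr_ge0 ?oppr_ge0 ?(ltW t0) ?(ltW a0) // => /(_ isT).
  rewrite (_ : _ + (t * - a) *: e = (1 + t * b) *: v); last by rewrite wE; vec.
  rewrite nvw normZ_ge0 // v1 => H; apply: (mulfI (lt0r_neq0 t0)); lra.
have [l yE] := on_line _ _ Gu u1 ue y1 uy.
exists l => //; rewrite leNgt; apply/negP => l0.
have [v [v1 Gv v_off]] := apex_cone_unit_off e u (ex_intro apex_cone u Gu).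
have ve : v <> e by move=> ve; apply: (v_off 1 0); rewrite ve; vec.
have vu : `|v + u| = 2.
  have : `|v + ((- l) *: u + y)| = `|v| + (`|(- l) *: u| + `|y|).
    rewrite (_ : _ + y = (1 - l) *: e); last by rewrite yE; vec.
    rewrite apex_cone_norm //; last by lra.
    by rewrite normZ_ge0 ?u1 ?y1; lra.
  move=> /norm_additive_split H.
  have : `|1 *: v + (- l)^-1 *: ((- l) *: u)| = 1 * `|v| + (- l)^-1 * `|(- l) *: u|.
    by apply: norm_additive => //; rewrite invr_ge0; lra.
  rewrite scalerA normZ_ge0; last by lra.
  rewrite mulrA mulVf; last by apply/eqP; lra.
  by rewrite !scale1r v1 u1 => ->; lra.
have [k uE] := on_line _ _ Gv v1 ve u1 vu.
have k0 : k != 0 by apply/eqP => k0; apply: ue; rewrite uE k0; vec.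
by apply: (v_off (1 - k^-1) k^-1); rewrite uE; vfield.
Qed.

End ApexCone.

(** * Directional derivatives of the norm *)

Section DirectionalDerivative.
Context {R : realType} {V : normedModType R}.
Implicit Types (x z w k : V) (s t : R).

(** The one-sided directional derivative of the norm at z; by convexity the
    difference quotients decrease to it, so it is an infimum. *)
Definition dirder z w : R :=
  inf [set (`|z + t *: w| - `|z|) / t | t in [set t : R | 0 < t]].

Lemma dirder_le z w t : 0 <= t -> `|z| + t * dirder z w <= `|z + t *: w|.
Proof.
rewrite le_eqVlt => /predU1P[<-|t0]; first by rewrite scale0r mul0r !addr0.
rewrite -lerBrDl -ler_pdivlMl // mulrC; apply: ge_inf; last by exists t.
exists (- `|w|) => _ [r /= r0 <-]; rewrite ler_pdivlMr //.
have : `|z| <= `|z + r *: w| + `|(- r) *: w| by apply: normD_le; vec.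
by rewrite scaleNr normrN normZ_ge0 ?(ltW r0) //; lra.
Qed.

Lemma dirder_ge z w e : 0 < e ->
  exists2 r : R, 0 < r &
    forall t, 0 <= t <= r -> `|z + t *: w| <= `|z| + t * (dirder z w + e).
Proof.
move=> e0; pose S := [set (`|z + t *: w| - `|z|) / t | t in [set t : R | 0 < t]].
have infS : has_inf S.
  split; first by exists ((`|z + 1 *: w| - `|z|) / 1); exists 1 => //=.
  exists (dirder z w) => _ [t t0 <-]; rewrite ler_pdivlMr // lerBrDl mulrC.
  exact/dirder_le/ltW.
have [_ [r r0 <-]] := inf_adherent e0 infS.
rewrite -/(dirder z w) ltr_pdivrMr // => /ltW zr.
exists r => // t /andP[t0 tr].
have ur : t / r <= 1 by rewrite ler_pdivrMr // mul1r.
have u0 : 0 <= t / r by rewrite divr_ge0 // ltW.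
have : `|(1 - t / r) *: z + (t / r) *: (z + r *: w)| <=
    (1 - t / r) * `|z| + (t / r) * `|z + r *: w|.
  by apply: norm_convex => //; lra.
have -> : (1 - t / r) *: z + (t / r) *: (z + r *: w) = z + t *: w.
  by vfield; rewrite gt_eqF.
have : (t / r) * (`|z + r *: w| - `|z|) <= t * (dirder z w + e).
  rewrite -[X in _ <= X](_ : (t / r) * ((dirder z w + e) * r) = _); last first.
    by field; rewrite gt_eqF.
  by rewrite ler_wpM2l.
lra.
Qed.

Lemma dirderD z w1 w2 : dirder z (w1 + w2) <= dirder z w1 + dirder z w2.
Proof.
apply/ler_addgt0Pr => e e0.
have e2 : 0 < e / 2 by lra.
have [r1 r10 z1] := dirder_ge z w1 e2.
have [r2 r20 z2] := dirder_ge z w2 e2.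
pose t := Num.min r1 r2 / 2.
have t0 : 0 < t by rewrite divr_gt0 // lt_min r10 r20.
have [t1 t2] : t * 2 <= r1 /\ t * 2 <= r2.
  by rewrite divfK ?gt_eqF // !ge_min !lexx orbT.
have := z1 (t * 2); rewrite mulr_ge0 ?(ltW t0) //= => /(_ t1).
have := z2 (t * 2); rewrite mulr_ge0 ?(ltW t0) //= => /(_ t2).
have := dirder_le z (w1 + w2) (ltW t0).
have : `|(1 / 2) *: (z + (t * 2) *: w1) + (1 / 2) *: (z + (t * 2) *: w2)| <=
    1 / 2 * `|z + (t * 2) *: w1| + 1 / 2 * `|z + (t * 2) *: w2|.
  by apply: norm_convex; lra.
have -> : (1 / 2) *: (z + (t * 2) *: w1) + (1 / 2) *: (z + (t * 2) *: w2) =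
    z + t *: (w1 + w2) by vfield.
by move=> *; rewrite -(ler_pM2l t0); lra.
Qed.

(** A small second difference bounds the gap between the two one-sided
    derivatives; unlike differentiability, this is an open condition. *)
Definition nearly_smooth (e : R) (w : V) : set V :=
  [set z | exists2 t : R, 0 < t & `|z + t *: w| + `|z - t *: w| < 2 * `|z| + e * t].

Lemma nearly_smooth_dirder e w z : nearly_smooth e w z ->
  dirder z w + dirder z (- w) < e.
Proof.
case=> t t0; rewrite -scalerN => zt.
have := dirder_le z w (ltW t0); have := dirder_le z (- w) (ltW t0).
by move=> *; rewrite -(ltr_pM2l t0); lra.
Qed.

Lemma nearly_smooth_open e w : open (nearly_smooth e w).
Proof.
apply/openP => z [t t0 zt].
pose d := 2 * `|z| + e * t - (`|z + t *: w| + `|z - t *: w|).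
have d0 : 0 < d by rewrite subr_gt0.
exists (d / 4) => [|x xz]; first by rewrite divr_gt0.
exists t => //.
have : `|x + t *: w| <= `|x - z| + `|z + t *: w| by apply: normD_le; vec.
have : `|x - t *: w| <= `|x - z| + `|z - t *: w| by apply: normD_le; vec.
have : `|z| <= `|z - x| + `|x| by apply: normD_le; vec.
by rewrite [`|z - x|]distrC /d in xz *; lra.
Qed.

(** If the condition fails along a whole progression of points y 0, y 1, ... of
    step t w, the increments of the norm grow by at least e t at each step,
    although they always lie between - t |w| and t |w|. *)
Lemma nearly_smooth_dense e w (G : set V) : 0 < e -> open G -> G !=set0 ->
  exists2 z, G z & nearly_smooth e w z.
Proof.
move=> e0 /openP oG [z0 Gz0]; apply/not_exists2P => rough.
have [r r0 zG] := oG _ Gz0.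
(* After n steps the accumulated growth n e t exceeds 2 t |w|, while t is small
   enough for the n + 2 points of the progression to stay in the ball. *)
pose n := (Num.truncn (2 * `|w| / e)).+1.
have ne : 2 * `|w| < n%:R * e.
  by rewrite -ltr_pdivrMr // truncnS_gt.
have w1 : 0 < 1 + `|w| by rewrite ltr_pwDl.
have [t t0 tE] : exists2 t : R, 0 < t & n.+2%:R * t * (1 + `|w|) = r.
  exists (r / (n.+2%:R * (1 + `|w|))); last first.
    by field; rewrite !gt_eqF //= ltr0n.
  by rewrite divr_gt0 // mulr_gt0 // ltr0n.
pose y i := z0 + (i%:R * t) *: w.
have inG i : (i <= n.+1)%N -> G (y i).
  move=> le_i; apply: zG; rewrite /y addrC addKr normZ_ge0; last first.
    by rewrite mulr_ge0 // ltW.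
  rewrite -tE -!mulrA; apply: ltr_pM; rewrite ?ltr_nat ?ltnS //.
    by rewrite mulr_ge0 // ltW.
  by rewrite ltr_pM2l // ltrDr.
have bend i : (i <= n)%N -> i%:R * (e * t) - t * `|w| <= `|y i.+1| - `|y i|.
  elim: i => [_|i IHi lt_i].
    rewrite mul0r sub0r.
    have : `|y 0%N| <= `|y 1%N| + `|(- t) *: w|.
      by apply: normD_le; rewrite /y; vec.
    by rewrite scaleNr normrN normZ_ge0 ?(ltW t0) //; lra.
  have bump : 2 * `|y i.+1| + e * t <= `|y i.+2| + `|y i|.
    rewrite leNgt; apply/negP => lt_bump.
    have [|] := rough (y i.+1); first by apply; apply: inG; rewrite ltnS ltnW.
    apply; exists t => //.
    rewrite (_ : y i.+1 + t *: w = y i.+2); last by rewrite /y -!natr1; vec.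
    by rewrite (_ : y i.+1 - t *: w = y i) //; rewrite /y -!natr1; vec.
  by have := IHi (ltnW lt_i); rewrite -[in i.+1%:R]natr1 mulrDl mul1r; lra.
have := bend _ (leqnn n).
have : `|y n.+1| <= `|y n| + `|t *: w|.
  by apply: normD_le; rewrite /y -!natr1; vec.
rewrite normZ_ge0 ?(ltW t0) // => H1 H2.
have : t * (2 * `|w|) < t * (n%:R * e) by rewrite ltr_pM2l.
lra.
Qed.

End DirectionalDerivative.

(** * Additivity near the apex *)

Section LinearPatch.
Context {R : realType} {X Y : normedModType R}.
Hypothesis dimX : Vector.axiom 3 X.
Hypothesis nocone : ~ fixed_direction_cylindrical_open_cone X.
Variable e : X.
Hypothesis norm_e : `|e| = 1.
Let Gam := apex_cone e.
Hypothesis neG : Gam !=set0.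
Variable F : X -> Y.
Hypothesis isoF : spherical_isometry F.
Let P x := - F (- x).
Let isoP : spherical_isometry P := sph_opp isoF.

Let cross x y : `|x| = `|y| -> `|F x + P y| = `|x + y|.
Proof. exact: sph_dist_opp. Qed.

(** The segment from P e to F u lies in the star of F u, and P pulls this star
    back into the star of u, which lies on the ray from e through u. The
    distance to P e then determines the parameter on the ray. *)
Lemma opp_segment u (s : R) : Gam u -> `|u| = 1 -> u <> e -> 0 <= s <= 1 ->
  P (e + (s * (`|F u - P e| / `|u - e|)) *: (u - e)) =
  (1 - s) *: P e + s *: F u.
Proof.
move=> Gu u1 ue /andP[s0 s1].
have ue0 : `|u - e| != 0 by rewrite normr_eq0 subr_eq0; apply/eqP.
have Pe1 : `|P e| = 1 by rewrite (sph_norm isoP).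
have Fu1 : `|F u| = 1 by rewrite (sph_norm isoF).
have add : `|P e + F u| = `|P e| + `|F u|.
  by rewrite addrC cross ?u1 // apex_cone_additive // u1 Pe1 Fu1.
have [y Py] := sph_surj isoP ((1 - s) *: P e + s *: F u).
have y1 : `|y| = 1.
  rewrite -(sph_norm isoP) Py norm_additive //; last by lra.
  by rewrite Pe1 Fu1; lra.
have uy : `|u + y| = 2.
  rewrite -cross ?u1 // Py.
  rewrite (_ : F u + _ = (1 - s) *: P e + (1 + s) *: F u); last by vec.
  by rewrite norm_additive //; [rewrite Pe1 Fu1|..]; lra.
have [l l0 yE] := star_ray norm_e dimX nocone Gu u1 ue y1 uy.
rewrite -Py; congr P; rewrite yE; congr (_ + _ *: _).
apply: (mulIf ue0); rewrite mulrA divfK // -(normZ_ge0 _ l0).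
rewrite (_ : l *: (u - e) = y - e); last by rewrite yE; vec.
rewrite -(sph_dist isoP) ?y1 // Py.
rewrite (_ : (1 - s) *: P e + _ - P e = s *: (F u - P e)); last by vec.
by rewrite normZ_ge0.
Qed.

Let point u s := (1 - s) *: e + s *: u.

Let pointP u s : Gam u -> `|u| = 1 -> u <> e -> 0 < s <= 1 ->
  [/\ Gam (point u s), `|point u s| = 1 & point u s <> e].
Proof.
move=> Gu u1 ue /andP[s0 s1].
have Gsu : Gam (s *: u) by apply: (apex_cone_cone _).2.
have s'0 : 0 <= 1 - s by lra.
rewrite /point addrC; split; first exact: apex_cone_shift.
  by rewrite (apex_cone_norm Gsu s'0) normZ_ge0 ?(ltW s0) // u1; lra.
move=> E; apply: ue; apply: (scalerI (lt0r_neq0 s0)).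
by apply: (addIr ((1 - s) *: e)); rewrite E; vec.
Qed.

(** Let P e' = F e. Points of the ray through u near e are mapped by F into the
    P-image of the same ray, so in the limit e' lies on that ray. As this holds
    for every u, and e' <> e would put every u in the plane of e and e', the
    points e and e' coincide. *)
Lemma apex_antipodal : P e = F e.
Proof.
have [e' Pe'] := sph_surj isoP (F e); rewrite -Pe'; congr P.
have e'1 : `|e'| = 1 by rewrite -(sph_norm isoP) Pe' (sph_norm isoF).
(* The parameter of e' on the ray is forced by its distance to e. *)
have ray u : Gam u -> `|u| = 1 -> u <> e ->
    e' = e + (`|e' - e| / `|u - e|) *: (u - e).
  move=> Gu u1 ue.
  have ue0 : `|u - e| != 0 by rewrite normr_eq0 subr_eq0; apply/eqP.
  have d0 : 0 < `|u - e| by rewrite lt_neqAle eq_sym ue0 normr_ge0.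
  have close (s : R) : 0 < s <= 1 ->
      `|e' - (e + (`|e' - e| / `|u - e|) *: (u - e))| <= 2 * s * `|u - e|.
    move=> s01; have [Gp p1 pe] := pointP Gu u1 ue s01.
    have /andP[s0 s1] := s01.
    have := opp_segment Gp p1 pe (s := 1); rewrite ler01 lexx => /(_ isT).
    rewrite subrr scale0r add0r scale1r mul1r.
    set y := e + _ => Py.
    have peE : point u s - e = s *: (u - e) by rewrite /point; vec.
    have npe : `|point u s - e| = s * `|u - e| by rewrite peE normZ_ge0 // ltW.
    have y1 : `|y| = 1 by rewrite -(sph_norm isoP) Py (sph_norm isoF).
    have ye' : `|y - e'| = s * `|u - e|.
      rewrite -(sph_dist isoP) ?y1 ?e'1 // Py Pe' (sph_dist isoF) //.
      by rewrite p1.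
    have [k k0 yE] : exists2 k : R, 0 <= k & y = e + k *: (u - e).
      exists (`|F (point u s) - P e| / `|point u s - e| * s).
        by rewrite mulr_ge0 ?divr_ge0 // ltW.
      by rewrite /y peE scalerA.
    have kd : `|y - e| = k * `|u - e|.
      by rewrite yE addrC addKr normZ_ge0.
    have t1 : `|y - e| <= `|y - e'| + `|e' - e| by apply: normD_le; vec.
    have t2 : `|e' - e| <= `|e' - y| + `|y - e| by apply: normD_le; vec.
    rewrite [`|e' - y|]distrC in t2.
    have : `|e' - (e + (`|e' - e| / `|u - e|) *: (u - e))| <=
        `|e' - y| + `|(k - `|e' - e| / `|u - e|) *: (u - e)|.
      by apply: normD_le; rewrite yE; vec.
    rewrite [`|e' - y|]distrC normrZ -[`|u - e| in X in _ + _ * X]normr_id.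
    rewrite -normrM mulrBl divfK //.
    have : `|k * `|u - e| - `|e' - e| | <= s * `|u - e| by rewrite ler_norml; lra.
    by lra.
  apply/eqP; rewrite -subr_eq0 -normr_eq0 -[_ == 0]negbK; apply/negP => D0.
  have {}D0 : 0 < `|e' - (e + (`|e' - e| / `|u - e|) *: (u - e))|.
    by rewrite lt_neqAle eq_sym D0 normr_ge0.
  move: close D0; set D := `|e' - (e + _)| => close D0.
  (* For this s the bound 2 s |u - e| is at most D / 2. *)
pose s := Num.min 1 (D / (4 * `|u - e|)).
  have s0 : 0 < s by rewrite lt_min ltr01 divr_gt0 // mulr_gt0.
  have := close s; rewrite s0 ge_min lexx => /(_ isT).
  have : s * (4 * `|u - e|) <= D.
    by rewrite -ler_pdivlMr ?mulr_gt0 // ge_min lexx orbT.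
  by rewrite mulrCA -mulrA; lra.
have [u [u1 Gu u_off]] := apex_cone_unit_off norm_e dimX e e' neG.
have ue : u <> e by move=> ue; apply: (u_off 1 0); rewrite ue; vec.
apply/eqP/negPn/negP => e'e.
have ue0 : `|u - e| != 0 by rewrite normr_eq0 subr_eq0; apply/eqP.
have e'e0 : `|e' - e| != 0 by rewrite normr_eq0 subr_eq0 eq_sym.
pose c := `|u - e| / `|e' - e|.
apply: (u_off (1 - c) c).
have : c *: e' = c *: e + u - e.
  by rewrite (ray u Gu u1 ue) scalerDr scalerA /c -addrA; congr (_ + _);
    rewrite mulrA divfK // mulfV // scale1r.
by move=> ->; vec.
Qed.

Lemma antipodal_on_apex_cone z : Gam z -> P z = F z.
Proof.
suff unit u : Gam u -> `|u| = 1 -> P u = F u.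
  move=> Gz; have z0 := apex_cone_neq0 norm_e Gz.
  rewrite -[z](normalizeK z0) (sph_homog isoP) // (sph_homog isoF) // unit //.
    by apply: (apex_cone_cone _).2; rewrite ?invr_gt0 ?normr_gt0.
  exact: unit_normalize.
move=> Gu u1; have [->|/eqP ue] := eqVneq u e; first exact: apex_antipodal.
have := opp_segment Gu u1 ue (s := 1); rewrite ler01 lexx => /(_ isT).
rewrite apex_antipodal (sph_dist isoF) ?u1 // mulfV; last first.
  by rewrite normr_eq0 subr_eq0; apply/eqP.
rewrite mulr1 (_ : e + _ = u); last by vec.
by move=> ->; vec.
Qed.

Lemma segment_affine u (s : R) : Gam u -> `|u| = 1 -> 0 < s <= 1 ->
  F (point u s) = (1 - s) *: F e + s *: F u.
Proof.
move=> Gu u1 s01; have [->|/eqP ue] := eqVneq u e.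
  by rewrite (_ : point e s = e) /point; vec.
have [Gp p1 pe] := pointP Gu u1 ue s01; have /andP[s0 s1] := s01.
rewrite -antipodal_on_apex_cone //.
have := opp_segment Gu u1 ue (s := s); rewrite (ltW s0) s1 => /(_ isT).
rewrite apex_antipodal (sph_dist isoF) ?u1 // mulfV; last first.
  by rewrite normr_eq0 subr_eq0; apply/eqP.
by rewrite mulr1 => <-; congr P; rewrite /point; vec.
Qed.

Lemma apex_shift z (t : R) : Gam z -> 0 <= t -> F (z + t *: e) = F z + t *: F e.
Proof.
move=> Gz t0; have z0 := apex_cone_neq0 norm_e Gz.
have nz : 0 < `|z| by rewrite normr_gt0.
have nzt : 0 < `|z| + t by rewrite ltr_pwDl.
pose s := `|z| / (`|z| + t).
have s01 : 0 < s <= 1.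
  by rewrite divr_gt0 //= ler_pdivrMr // mul1r lerDl.
have Gu : Gam (`|z|^-1 *: z).
  by apply: (apex_cone_cone _).2; rewrite ?invr_gt0.
have := segment_affine Gu (unit_normalize z0) s01.
move=> /(congr1 (fun y => (`|z| + t) *: y)).
rewrite (sph_homog isoF (a := `|z|^-1)) ?invr_ge0 // -(sph_homog isoF _ (ltW nzt)).
have -> : (`|z| + t) *: point (`|z|^-1 *: z) s = z + t *: e.
  by rewrite /point /s; vfield; rewrite !gt_eqF.
by move=> ->; rewrite /s; vfield; rewrite !gt_eqF.
Qed.

Lemma apex_image_norm y (t : R) : (F @` Gam) y -> 0 <= t ->
  `|y + t *: F e| = `|y| + t.
Proof.
move=> [z Gz <-] t0.
by rewrite -apex_shift // !(sph_norm isoF) (apex_cone_norm Gz).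
Qed.

(** Adding the multiple of e that brings t w to the norm of z turns the sum into
    one of two vectors of equal norm, which is measured through P = F; the added
    multiple is then removed on both sides by additivity of e and F e. *)
Lemma norm_sum_local z w : Gam z -> Gam w -> exists2 r : R, 0 < r &
  forall t, 0 <= t < r -> `|F z + t *: F w| = `|z + t *: w|.
Proof.
move=> Gz Gw.
have z0 : 0 < `|z| by rewrite normr_gt0 (apex_cone_neq0 norm_e).
have w0 : 0 < `|w| by rewrite normr_gt0 (apex_cone_neq0 norm_e).
have [r r0 zr] := (openP _).1 (apex_cone_open e) _ Gz.
have [r' r'0 zr'] := (openP _).1 (sph_open isoF (apex_cone_open e)) _
  (ex_intro2 _ _ _ Gz erefl).
pose m := Num.min (Num.min r r') `|z|.
have m0 : 0 < m by rewrite !lt_min r0 r'0 z0.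
exists (m / `|w|) => [|t]; first exact: divr_gt0.
rewrite ltr_pdivlMr // !lt_min => /andP[t0 /andP[/andP[tr tr'] tz]].
have [->|/eqP tn0] := eqVneq t 0.
  by rewrite !scale0r !addr0 (sph_norm isoF).
have {}t0 : 0 < t by rewrite lt_neqAle t0 andbT eq_sym; apply/eqP.
have Gzt : Gam (z + t *: w).
  by apply: zr; rewrite addrC addKr normZ_ge0 // ltW.
have FGzt : (F @` Gam) (F z + t *: F w).
  by apply: zr'; rewrite addrC addKr normZ_ge0 ?(ltW t0) // (sph_norm isoF).
have Gtw : Gam (t *: w) by apply: (apex_cone_cone _).2.
have s0 : 0 <= `|z| - t * `|w| by rewrite subr_ge0 ltW.
have := cross (x := z) (y := t *: w + (`|z| - t * `|w|) *: e).
rewrite (apex_cone_norm Gtw s0) normZ_ge0 ?(ltW t0) // addrC subrK => /(_ erefl).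
rewrite antipodal_on_apex_cone; last exact: apex_cone_shift.
rewrite apex_shift // (sph_homog isoF) ?(ltW t0) // !addrA.
by rewrite apex_image_norm // (apex_cone_norm Gzt) // => /addIr.
Qed.

Lemma dirder_image z w : Gam z -> Gam w -> dirder (F z) (F w) = dirder z w.
Proof.
move=> Gz Gw; have [r r0 zr] := norm_sum_local Gz Gw.
apply/eqP; rewrite eq_le; apply/andP; split; apply/ler_addgt0Pr => d d0.
  have [r' r'0 zr'] := dirder_ge z w d0.
  pose t := Num.min r r' / 2.
  have t0 : 0 < t by rewrite divr_gt0 // lt_min r0 r'0.
  have [t1 t2] : t * 2 <= r /\ t * 2 <= r'.
    by rewrite divfK ?gt_eqF // !ge_min !lexx orbT.
  have := dirder_le (F z) (F w) (ltW t0).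
  rewrite zr ?(ltW t0) /=; last by lra.
  have := zr' t; rewrite (ltW t0) (sph_norm isoF) => /(_ ltac:(lra)) H1 H2.
  by rewrite -(ler_pM2l t0); lra.
have [r' r'0 zr'] := dirder_ge (F z) (F w) d0.
pose t := Num.min r r' / 2.
have t0 : 0 < t by rewrite divr_gt0 // lt_min r0 r'0.
have [t1 t2] : t * 2 <= r /\ t * 2 <= r'.
  by rewrite divfK ?gt_eqF // !ge_min !lexx orbT.
have := dirder_le z w (ltW t0); rewrite -zr ?(ltW t0) /=; last by lra.
have := zr' t; rewrite (ltW t0) (sph_norm isoF) => /(_ ltac:(lra)) H1 H2.
by rewrite -(ler_pM2l t0); lra.
Qed.

(** At a point x where both norms are nearly smooth, in the directions w1 and
    F w1 respectively, the derivatives in the directions w1 and w2 nearly add up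
    on both sides. As F preserves derivatives, the derivative at x in the
    directions d and - d is at least - e2, where d = w3 - (w1 + w2). Density of
    such x makes d a flat direction. *)
Lemma locally_additive w1 w2 : Gam w1 -> Gam w2 ->
    (F @` Gam) (F w1 + F w2) ->
  Gam (w1 + w2) /\ F (w1 + w2) = F w1 + F w2.
Proof.
move=> Gw1 Gw2 [w3 Gw3 Fw3].
suff E : w3 - (w1 + w2) = 0.
  by move/eqP: E; rewrite subr_eq0 => /eqP <-.
set d := w3 - _.
have w3E : w3 = d + (w1 + w2) by rewrite /d; vec.
apply: (flat_direction_eq0 nocone (G := Gam)) => //.
- exact: apex_cone_cone.
- exact: apex_cone0.
move=> z s Gz; apply/ler_addgt0Pr => eps eps0.
(* Two thirds of eps pay for replacing z by x, one third for the slope e2. *)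
pose e1 := eps / 3; have e10 : 0 < e1 by rewrite divr_gt0.
have s1 : 0 < 1 + `|s| by rewrite ltr_pwDl.
pose e2 := e1 / (1 + `|s|); have e20 : 0 < e2 by rewrite divr_gt0.
have [G1 oG1 G1P] : exists2 G1 : set X, open G1 &
    G1 !=set0 /\ forall x, G1 x ->
      [/\ Gam x, `|x - z| < e1 & nearly_smooth e2 w1 x].
  have oB : open (Gam `&` ball z e1).
    by apply: openI; [exact: apex_cone_open | exact: ball_open].
  have [x [Gx zx] sx] := nearly_smooth_dense w1 e20 oB
    (ex_intro (Gam `&` ball z e1) z (conj Gz (ballxx z e10))).
  exists (Gam `&` ball z e1 `&` nearly_smooth e2 w1).
    by apply: openI => //; exact: nearly_smooth_open.
  split; first by exists x.
  by move=> y [[Gy]]; rewrite -ball_normE /= distrC.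
have [[x0 G1x0] {}G1P] := G1P.
have [_ [x G1x <-] sFx] := nearly_smooth_dense (F w1) e20 (sph_open isoF oG1)
  (ex_intro (F @` G1) _ (ex_intro2 _ _ _ G1x0 erefl)).
have [Gx xz sx] := G1P _ G1x.
have {}sx := nearly_smooth_dirder sx.
have {}sFx := nearly_smooth_dirder sFx.
have E1 := dirder_image Gx Gw1; have E2 := dirder_image Gx Gw2.
have := dirder_image Gx Gw3; rewrite Fw3 => E3.
(* I1 and I2 bound the derivative of the image norm along F w1 + F w2 from both
   sides, I3 and I4 the derivative along w1 + w2; I5 and I6 isolate d. *)
have I1 := dirderD (F x) (F w1) (F w2).
have I2 := dirderD (F x) (- F w1) (F w1 + F w2).
have I3 := dirderD x (- w1) (w1 + w2).
rewrite addrA addNr add0r in I2; rewrite addrA addNr add0r in I3.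
have I4 := dirderD x w1 w2.
have I5 := dirderD x d (w1 + w2); rewrite -w3E in I5.
have I6 := dirderD x (- d) w3.
rewrite (_ : - d + w3 = w1 + w2) in I6; last by rewrite /d; vec.
have low : `|x| - `|s| * e2 <= `|x + s *: d|.
  have [s0|s0] := leP 0 s.
    have := dirder_le x d s0.
    have : s * (- e2) <= s * dirder x d by rewrite ler_wpM2l //; lra.
    by rewrite (ger0_norm s0); lra.
  have s'0 : 0 <= - s by lra.
  have := dirder_le x (- d) s'0.
  have : (- s) * (- e2) <= (- s) * dirder x (- d) by rewrite ler_wpM2l //; lra.
  rewrite (_ : x + (- s) *: (- d) = x + s *: d); last by vec.
  by rewrite (ltr0_norm s0); lra.
have : `|s| * e2 <= e1.
  have : e2 * (1 + `|s|) = e1 by rewrite divfK ?gt_eqF.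
  by lra.
have : `|z| <= `|z - x| + `|x| by apply: normD_le; vec.
have : `|x + s *: d| <= `|x - z| + `|z + s *: d| by apply: normD_le; vec.
rewrite [`|z - x|]distrC /e1 in xz *; lra.
Qed.

End LinearPatch.

(** * A linear patch *)

Section LinearPatchExists.
Context {R : realType} {X Y : normedModType R}.
Hypothesis dimX : Vector.axiom 3 X.
Hypothesis nocone : ~ fixed_direction_cylindrical_open_cone X.

(** Three independent vectors of the apex cone whose images lie in a small ball
    define T; additivity spreads the agreement to the cone that they span. An
    element of the kernel of T is a flat direction of this cone, so T is
    injective, and T is onto because its range contains an open set. *)
Lemma linear_patch (e : X) (F : X -> Y) :
    `|e| = 1 -> apex_cone e !=set0 -> spherical_isometry F ->
  exists (T : {linear X -> Y}) (G : set X),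
    [/\ injective T, (forall y, exists x, T x = y), open G, G !=set0 &
        forall z, G z -> F z = T z /\ F (- z) = - T z].
Proof.
move=> norm_e [z0 Gz0] isoF.
have oFG := sph_open isoF (apex_cone_open e).
have [r r0 yr] := (openP _).1 oFG _ (ex_intro2 _ _ _ Gz0 erefl).
have r3 : 0 < r / 3 by rewrite divr_gt0.
have oB : open (apex_cone e `&` ball z0 (r / 3)).
  by apply: openI; [exact: apex_cone_open | exact: ball_open].
have [x [y [z [Bx By Bz indep]]]] := independent_in_open dimX oB
  (ex_intro (apex_cone e `&` ball z0 (r / 3)) z0 (conj Gz0 (ballxx z0 r3))).
have near_image v : (apex_cone e `&` ball z0 (r / 3)) v ->
    apex_cone e v /\ `|F v - F z0| < r.
  move=> [Gv]; rewrite -ball_normE /= distrC => vz0; split=> //.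
  by have := sph_lipschitz isoF v z0; lra.
have {Bx} [Gx Fx] := near_image _ Bx.
have {By} [Gy Fy] := near_image _ By.
have {Bz} [Gz Fz] := near_image _ Bz.
have inFG a b c : 0 < a -> 0 < b -> 0 <= c ->
    (F @` apex_cone e) (a *: F x + b *: F y + c *: F z).
  move=> a0 b0 c0.
  have s0 : 0 < a + b + c by lra.
  have [w Gw Fw] :
      (F @` apex_cone e) ((a + b + c)^-1 *: (a *: F x + b *: F y + c *: F z)).
    apply: yr; rewrite -(ltr_pM2l s0) -normZ_ge0 ?(ltW s0) //.
    have -> : (a + b + c) *:
          ((a + b + c)^-1 *: (a *: F x + b *: F y + c *: F z) - F z0) =
        a *: (F x - F z0) + (b *: (F y - F z0) + c *: (F z - F z0)).
      by vfield; rewrite gt_eqF.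
    rewrite (le_lt_trans (ler_normD _ _)) //.
    have := ler_normD (b *: (F y - F z0)) (c *: (F z - F z0)).
    rewrite !normZ_ge0 ?(ltW a0) ?(ltW b0) //.
    have : a * `|F x - F z0| < a * r by rewrite ltr_pM2l.
    have : b * `|F y - F z0| < b * r by rewrite ltr_pM2l.
    have : c * `|F z - F z0| <= c * r by rewrite ler_wpM2l // ltW.
    by lra.
  exists ((a + b + c) *: w); first exact: (apex_cone_cone _).2.
  by rewrite (sph_homog isoF) ?(ltW s0) // Fw scalerA mulfV ?gt_eqF // scale1r.
pose Fxyz (i : 'I_3) := [:: F x; F y; F z]`_i.
have [T Ti] := linear_extension dimX Fxyz indep.
have Tx : T x = F x := Ti ord0.
have Ty : T y = F y := Ti (lift ord0 ord0).
have Tz : T z = F z := Ti (lift ord0 (lift ord0 ord0)).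
have addF := locally_additive dimX nocone norm_e (ex_intro _ z0 Gz0) isoF.
have scaleG (a : R) v : 0 < a -> apex_cone e v -> apex_cone e (a *: v).
  by move=> a0 Gv; exact: (apex_cone_cone _).2.
pose G := simplicial_cone x y z.
have GP w : G w -> apex_cone e w /\ F w = T w.
  move=> [a [b [c [a0 b0 c0 ->]]]].
  have [|Gab Fab] := addF (a *: x) (b *: y) (scaleG _ _ a0 Gx) (scaleG _ _ b0 Gy).
    rewrite !(sph_homog isoF) ?(ltW a0) ?(ltW b0) //.
    by have := inFG a b 0 a0 b0 (lexx 0); rewrite scale0r addr0.
  have [|Gabc Fabc] := addF _ (c *: z) Gab (scaleG _ _ c0 Gz).
    rewrite Fab !(sph_homog isoF) ?(ltW a0) ?(ltW b0) ?(ltW c0) //.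
    by apply: inFG => //; exact: ltW.
  split=> //; rewrite Fabc Fab !(sph_homog isoF) ?(ltW a0) ?(ltW b0) ?(ltW c0) //.
  by rewrite !linearD !linearZ /= Tx Ty Tz.
have coneG : open_cone G := simplicial_cone_open_cone dimX indep.
have G1 : G (1 *: x + 1 *: y + 1 *: z) by exists 1, 1, 1; do !split.
exists T, G; split.
- move=> v w Tvw; apply/eqP; rewrite -subr_eq0; apply/eqP.
  apply: (locally_flat_direction_eq0 nocone (G := G)) => //; last 1 first.
  + move=> u Gu; have [d d0 ud] := (openP _).1 coneG.1 _ Gu.
    pose n := 1 + `|v - w|.
    have n0 : 0 < n by rewrite ltr_pwDl.
    exists (d / n) => [|s]; first exact: divr_gt0.
    rewrite ltr_pdivlMr // => sd.
    have Gs : G (u + s *: (v - w)).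
      apply: ud; rewrite addrC addKr normrZ (le_lt_trans _ sd) //.
      by rewrite ler_wpM2l // lerDr.
    rewrite -(sph_norm isoF) -[leRHS](sph_norm isoF) (GP _ Gu).2 (GP _ Gs).2.
    by rewrite linearD linearZ linearB /= Tvw subrr scaler0 addr0.
  + by move=> /GP[/(apex_cone0 norm_e)].
  + by exists (1 *: x + 1 *: y + 1 *: z).
- move=> y'; have [d d0 yd] := (openP _).1 (sph_open isoF coneG.1) _
    (ex_intro2 _ _ _ G1 erefl).
  set w0 := 1 *: x + 1 *: y + 1 *: z in G1 yd.
  pose n := 1 + `|y'|.
  have n0 : 0 < n by rewrite ltr_pwDl.
  have [w Gw Fw] : (F @` G) (F w0 + (d / n) *: y').
    apply: yd; rewrite (_ : _ - F w0 = (d / n) *: y'); last by vec.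
    rewrite normZ_ge0 ?divr_ge0 ?ltW //.
    by rewrite mulrAC ltr_pdivrMr // ltr_pM2l // ltrDr.
  exists ((d / n)^-1 *: (w - w0)).
  rewrite linearZ linearB /= -(GP _ Gw).2 Fw -(GP _ G1).2 addrC addKr.
  by rewrite scalerA mulVf ?scale1r // gt_eqF // divr_gt0.
- exact: coneG.1.
- by exists (1 *: x + 1 *: y + 1 *: z).
- move=> w /GP[Gw Fw]; split=> //.
  have := antipodal_on_apex_cone dimX nocone norm_e (ex_intro _ z0 Gz0) isoF Gw.
  by rewrite /= => FNw; rewrite -Fw -FNw opprK.
Qed.

End LinearPatchExists.

(** * Propagation of the agreement *)

Section Propagation.
Context {R : realType} {X Y : normedModType R}.
Hypothesis dimX : Vector.axiom 3 X.
Hypothesis nocone : ~ fixed_direction_cylindrical_open_cone X.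
Variable T : {linear X -> Y}.
Hypothesis injT : injective T.
Hypothesis surjT : forall y, exists x, T x = y.

Section ConvexCone.
Variable K : set X.
Hypothesis coneK : open_cone K.
Hypothesis addK : forall x y, K x -> K y -> K (x + y).
Hypothesis K0 : ~ K 0.
Variable x0 : X.
Hypothesis x0_neq0 : x0 != 0.
Hypothesis x0_adh : forall e : R, 0 < e -> exists2 u, K u & `|u - x0| < e.

Let n0 : 0 < `|x0|.
Proof. by rewrite normr_gt0. Qed.

Lemma add_adherent u : K u -> K (u + x0).
Proof.
move=> Ku; have [r r0 ur] := (openP K).1 coneK.1 _ Ku.
have [v Kv vx0] := x0_adh r0.
rewrite (_ : u + x0 = (u - (v - x0)) + v); last by vec.
by apply: addK => //; apply: ur; rewrite addrC addKr normrN.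
Qed.

Lemma rescale_close (x : X) : x != 0 ->
  `|(`|x0| / `|x|) *: x - x0| <= 2 * `|x - x0|.
Proof.
move=> x_neq0.
have : `|(`|x0| / `|x|) *: x - x0| <= `|(`|x0| / `|x| - 1) *: x| + `|x - x0|.
  by apply: normD_le; vec.
have -> : `|(`|x0| / `|x| - 1) *: x| = `| `|x0| - `|x| |.
  by rewrite normrZ -[X in _ * X]normr_id -normrM mulrBl divfK ?mul1r // normr_eq0.
have := lerB_dist x x0; have := lerB_dist x0 x; rewrite [`|x0 - x|]distrC => ? ?.
have : `| `|x0| - `|x| | <= `|x - x0| by rewrite ler_norml; lra.
by lra.
Qed.

Lemma norm_rescale (x : X) : x != 0 -> `|(`|x0| / `|x|) *: x| = `|x0|.
Proof. by move=> x_neq0; rewrite normZ_ge0 ?divr_ge0 // divfK // normr_eq0. Qed.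

(** The directions of the vectors u + x0 with u in K of norm |x0|, written as an
    open condition: a point z qualifies when the ray t z - x0, which stays in K
    from t = a on, crosses the sphere of radius |x0| between a and b. *)
Definition sphere_crossing_cone : set X :=
  [set z | K z /\ exists a b : R, [/\ 0 < a < b, K (a *: z - x0),
     `|a *: z - x0| < `|x0| & `|x0| < `|b *: z - x0|]].

Lemma sphere_crossing z : sphere_crossing_cone z ->
  exists m u, [/\ 0 < m, K u, `|u| = `|x0| & m *: z = u + x0].
Proof.
move=> [Kz [a [b [/andP[a0 ab] Ka lta ltb]]]].
have cont : {within `[a, b], continuous (fun m : R => `|m *: z - x0| : R)}.
  apply: continuous_subspaceT => m; apply: cvg_norm; apply: cvgB.
    by apply: cvgZr_tmp; exact: cvg_id.
  exact: cvg_cst.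
have [|m] := IVT (ltW ab) cont (v := `|x0|).
  by rewrite ge_min le_max (ltW lta) (ltW ltb) orbT.
rewrite in_itv /= => /andP[am mb] norm_m.
exists m, (m *: z - x0); split=> //; [lra| |by rewrite subrK].
have [->//|ma] := eqVneq m a.
rewrite (_ : m *: z - x0 = (a *: z - x0) + (m - a) *: z); last by vec.
by apply: addK => //; apply: coneK.2 => //; rewrite subr_gt0 lt_neqAle eq_sym ma.
Qed.

Lemma sphere_crossing_cone_open : open_cone sphere_crossing_cone.
Proof.
split=> [|c z c0 [Kz [a [b [/andP[a0 ab] Ka lta ltb]]]]]; last first.
  split; first exact: coneK.2.
  exists (a / c), (b / c); rewrite !scalerA !divfK ?gt_eqF //.
  by rewrite divr_gt0 // ltr_pM2r ?invr_gt0.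
apply/openP => z [Kz [a [b [/andP[a0 ab] Ka lta ltb]]]].
have [r r0 zr] := (openP K).1 coneK.1 _ Kz.
have [r1 r10 zr1] := (openP K).1 coneK.1 _ Ka.
have b0 : 0 < b by lra.
pose m := Num.min r1 (Num.min (`|x0| - `|a *: z - x0|) (`|b *: z - x0| - `|x0|)).
have m0 : 0 < m by rewrite !lt_min r10 !subr_gt0 lta.
have [m1 m2 m3] : [/\ m <= r1, m <= `|x0| - `|a *: z - x0| &
    m <= `|b *: z - x0| - `|x0| ].
  by rewrite /m !ge_min !lexx !orbT.
exists (Num.min r (m / b)) => [|x]; first by rewrite lt_min r0 divr_gt0.
rewrite lt_min ltr_pdivlMr // mulrC => /andP[xr xm].
have ax : a * `|x - z| <= b * `|x - z| by rewrite ler_wpM2r // ltW.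
split; first exact: zr.
exists a, b; split; first by rewrite a0.
- apply: zr1; rewrite (_ : _ - (a *: z - x0) = a *: (x - z)); last by vec.
  by rewrite normZ_ge0 ?(ltW a0) //; lra.
- have : `|a *: x - x0| <= `|a *: (x - z)| + `|a *: z - x0|.
    by apply: normD_le; vec.
  by rewrite normZ_ge0 ?(ltW a0) //; lra.
- have : `|b *: z - x0| <= `|(- b) *: (x - z)| + `|b *: x - x0|.
    by apply: normD_le; vec.
  by rewrite scaleNr normrN normZ_ge0 ?(ltW b0) //; lra.
Qed.

Lemma sphere_crossing_cone_nonempty : sphere_crossing_cone !=set0.
Proof.
have [v Kv vx0] : exists2 u, K u & `|u - x0| < `|x0| / 4.
  by apply: x0_adh; rewrite divr_gt0.
have v0 : v != 0 by apply/eqP => v0; apply: K0; rewrite -v0.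
have ux0 := rescale_close v0; have nu := norm_rescale v0.
have Ku : K ((`|x0| / `|v|) *: v).
  by apply: coneK.2 => //; rewrite divr_gt0 // normr_gt0.
move: ((`|x0| / `|v|) *: v) ux0 nu Ku => u ux0 nu Ku.
have [r r0 ur] := (openP K).1 coneK.1 _ Ku.
(* The witness is z = u + x0 with u in K, on the sphere and close to x0: the ray
   t z - x0 passes through u at t = 1, and the norm is below |x0| just before
   since it is at t = 1 / 2, and above |x0| at t = 2. *)
pose t := Num.min (1 / 2) (r / (4 * `|x0|)).
have t0 : 0 < t by rewrite lt_min !divr_gt0 // mulr_gt0.
have [t1 tr] : t <= 1 / 2 /\ t * (4 * `|x0|) <= r.
  by rewrite -ler_pdivlMr ?mulr_gt0 // !ge_min !lexx orbT.
exists (u + x0); split; first exact: add_adherent.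
exists (1 - t), 2; split; [by apply/andP; split; lra|..].
- apply: ur; rewrite (_ : _ - u = (- t) *: (u + x0)); last by vec.
  rewrite scaleNr normrN normZ_ge0 ?(ltW t0) //.
  have : t * `|u + x0| <= t * (2 * `|x0|).
    by rewrite ler_wpM2l ?(ltW t0) //; have := ler_normD u x0; lra.
  by have : 0 < t * `|x0| by [rewrite mulr_gt0]; lra.
- have : `|(1 - t) *: (u + x0) - x0| <= (1 - 2 * t) * `|u| + t * `|u - x0|.
    rewrite -!normZ_ge0 ?(ltW t0); [|lra..].
    by apply: normD_le; vec.
  have : t * `|u - x0| <= t * (`|x0| / 2) by rewrite ler_wpM2l ?(ltW t0) //; lra.
  have : 0 < t * `|x0| by rewrite mulr_gt0.
  by rewrite nu; lra.
- have : `|3 *: x0| <= `|2 *: (u + x0) - x0| + `|(- 2) *: (u - x0)|.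
    by apply: normD_le; vec.
  by rewrite scaleNr normrN !normZ_ge0 //; have := n0; lra.
Qed.

(** If x and g are equidistant from - u, then the norm takes the same value at
    both ends of the chord from u + x to u + g, so it is not smaller beyond the
    ends. As the chord shrinks to a point, the part beyond it becomes the whole
    line through u + x0 in a limit direction l, which is therefore flat. *)
Lemma no_pairs_at_equal_distance :
  ~ (forall d : R, 0 < d -> exists x g : X,
      [/\ g != x, `|x - x0| < d, `|g - x0| < d &
        forall u, K u -> `|u| = `|x0| -> K (g + u) -> `|u + g| = `|u + x| ]).
Proof.
move=> pairs.
have /choice[xg xgP] (n : nat) : exists p : X * X,
    [/\ p.2 != p.1, `|p.1 - x0| < n.+1%:R^-1, `|p.2 - x0| < n.+1%:R^-1 &
      forall u, K u -> `|u| = `|x0| -> K (p.2 + u) -> `|u + p.2| = `|u + p.1| ].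
  have [|x [g P]] := pairs n.+1%:R^-1; first by rewrite invr_gt0 ltr0n.
  by exists (x, g).
pose w n := (xg n).2 - (xg n).1.
have w0 n : 0 < `|w n| by rewrite normr_gt0 subr_eq0; have [] := xgP n.
pose k n := `|w n|^-1 *: w n.
have k1 n : `|k n| = 1 by apply: unit_normalize; rewrite -normr_gt0.
have k_le1 n : `|k n| <= 1 by rewrite k1.
have [l lP] := bounded_seq_cluster dimX k_le1.
have flat u (s : R) : K u -> `|u| = `|x0| -> `|u + x0| <= `|(u + x0) + s *: l|.
  move=> Ku nu; have [->|s0] := eqVneq s 0; first by rewrite scale0r addr0.
  apply/ler_addgt0Pr => e e0.
  have [r r0 ur] := (openP K).1 coneK.1 _ (add_adherent Ku).
  have abs_s : 0 < `|s| by rewrite normr_gt0.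
  pose m := Num.min (Num.min r (e / 3)) (`|s| / 2).
  have m0 : 0 < m by rewrite !lt_min r0 !divr_gt0.
  have [mr me ms] : [/\ m <= r, m <= e / 3 & m <= `|s| / 2].
    by rewrite /m !ge_min !lexx !orbT.
  have es0 : 0 < e / 3 / `|s| by rewrite !divr_gt0.
  have [n Nn kn] := lP _ es0 (Num.truncn m^-1).+1.
  have small : n.+1%:R^-1 < m.
    rewrite -[m]invrK ltf_pV2 ?posrE ?invr_gt0 ?ltr0n //.
    by apply: lt_le_trans (truncnS_gt _) _; rewrite ler_nat ltnW.
  have [_ xn gn eqn] := xgP n.
  move: (n.+1%:R^-1) small xn gn => q small xn gn.
  have Kgu : K ((xg n).2 + u).
    apply: ur; rewrite (_ : _ - (u + x0) = (xg n).2 - x0); last by vec.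
    by lra.
  have := eqn u Ku nu Kgu.
  rewrite (_ : u + (xg n).2 = (u + (xg n).1) + `|w n| *: k n); last first.
    by rewrite normalizeK -?normr_gt0 // /w; vec.
  move=> chord.
  have wn : `|w n| < `|s|.
    have : `|w n| <= `|(xg n).2 - x0| + `|x0 - (xg n).1|.
      by apply: normD_le; rewrite /w; vec.
    by rewrite [`|x0 - _|]distrC; lra.
  have := norm_min_of_flat_chord (s := s) (w0 n) chord.
  have -> : (s <= 0) || (`|w n| <= s).
    have [s_le0//|s_gt0] := leP s 0.
    by rewrite (gtr0_norm s_gt0) in wn; rewrite ltW.
  move=> /(_ isT).
  have : `|u + x0| <= `|u + (xg n).1| + `|x0 - (xg n).1|.
    by apply: normD_le; vec.
  have : `|u + (xg n).1 + s *: k n| <=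
      `|u + x0 + s *: l| + (`|(xg n).1 - x0| + `|s *: (k n - l)|).
    rewrite (_ : u + (xg n).1 + s *: k n =
      (u + x0 + s *: l) + (((xg n).1 - x0) + s *: (k n - l))); last by vec.
    by rewrite (le_trans (ler_normD _ _)) // lerD2l ler_normD.
  rewrite [`|x0 - _|]distrC normrZ.
  have : `|s| * `|k n - l| < e / 3 by rewrite mulrC -ltr_pdivlMr.
  by lra.
have l0 : l = 0.
  apply: (flat_direction_eq0 nocone (G := sphere_crossing_cone)).
  - exact: sphere_crossing_cone_open.
  - by case.
  - exact: sphere_crossing_cone_nonempty.
  move=> z s /sphere_crossing[m [u [m0 Ku nu mz]]].
  have := flat u (m * s) Ku nu; rewrite -mz.
  rewrite (_ : m *: z + _ = m *: (z + s *: l)); last by vec.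
  by rewrite !normZ_ge0 ?(ltW m0) // ler_pM2l.
have [n _] := lP 1 ltr01 0%N.
by rewrite l0 subr0 k1 ltxx.
Qed.

(** A failure at x produces g with T g = - F (- x), different from x but as
    close to x0, and K-points u of the same norm as x satisfy
    |u + g| = |T u + T g| = |F u - F (- x)| = |u + x|. *)
Lemma agreement_extends (F : X -> Y) : spherical_isometry F ->
    (forall z, K z -> F z = T z /\ F (- z) = - T z) ->
  exists2 d : R, 0 < d & forall x, `|x - x0| < d -> F (- x) = - T x.
Proof.
move=> isoF FT; apply: contrapT => nonext; apply: no_pairs_at_equal_distance.
have [B B0 TB] := linear_bounded dimX T.
have [C C0 TC] := injective_bounded_below dimX injT.
move=> d d0.
pose D := 1 + C * (3 + B).
have CB0 : 0 < C * (3 + B) by rewrite mulr_gt0 //; lra.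
have D0 : 0 < D by rewrite /D; lra.
(* The factor 4 absorbs the loss of 2 when x1 is rescaled to the norm of x0, and
   D bounds the distances of x and g to x0 in terms of |x - x0|. *)
have [x1 x1x0 bad1] : exists2 x : X, `|x - x0| < Num.min (d / (4 * D)) `|x0| &
    F (- x) <> - T x.
  apply: contrapT => good; apply: nonext.
  exists (Num.min (d / (4 * D)) `|x0|).
    by rewrite lt_min n0 divr_gt0 // mulr_gt0.
  by move=> x xx0; apply: contrapT => bad; apply: good; exists x.
have x1_neq0 : x1 != 0.
  by apply/eqP => x10; apply: bad1; rewrite x10 (linear0 T) oppr0 (sph0 isoF) oppr0.
have xx0 := rescale_close x1_neq0; have nx := norm_rescale x1_neq0.
have bad : F (- ((`|x0| / `|x1|) *: x1)) <> - T ((`|x0| / `|x1|) *: x1).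
  have a0 : 0 < `|x0| / `|x1| by rewrite divr_gt0 ?n0 // normr_gt0.
  rewrite -scalerN (sph_homog isoF _ (ltW a0)) linearZ -scalerN /=.
  by move=> /(scalerI (lt0r_neq0 a0)).
move: ((`|x0| / `|x1|) *: x1) xx0 nx bad => x xx0 nx bad.
have {x1x0} xd : 2 * D * `|x - x0| < d.
  move: x1x0; rewrite lt_min ltr_pdivlMr ?mulr_gt0 // => /andP[x1d _].
  have : D * `|x - x0| <= D * (2 * `|x1 - x0|) by rewrite ler_pM2l.
  by lra.
have [g Tg] := surjT (- F (- x)).
have Tsub a b : T (a - b) = T a - T b by exact: linearB.
have gx : `|g - x| <= C * (3 + B) * `|x - x0|.
  rewrite (le_trans (TC _)) // -mulrA ler_pM2l //; apply/ler_addgt0Pr => e e0.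
  have B3 : 0 < 3 + B by lra.
  have [u Ku ux0] := x0_adh (divr_gt0 e0 B3).
  have : `|T (g - x)| <= `|F (- u) - F (- x)| + `|T (u - x)|.
    by apply: normD_le; rewrite !Tsub Tg (FT _ Ku).2; vec.
  have := sph_lipschitz isoF (- u) (- x).
  rewrite (_ : - u - - x = x - u); last by vec.
  rewrite [`|x - u|]distrC => lipF; have := TB (u - x).
  have : (3 + B) * `|u - x| <= (3 + B) * (`|u - x0| + `|x0 - x|).
    by rewrite ler_pM2l //; apply: normD_le; vec.
  rewrite [`|x0 - x|]distrC.
  have : (3 + B) * `|u - x0| < e by rewrite mulrC -ltr_pdivlMr.
  by lra.
exists x, g; split.
- by apply/eqP => gx_eq; apply: bad; rewrite -gx_eq Tg gx_eq opprK.
- have : 0 <= C * (3 + B) * `|x - x0| by rewrite mulr_ge0 // ltW.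
  by have := normr_ge0 (x - x0); rewrite /D in xd; lra.
- have : `|g - x0| <= `|g - x| + `|x - x0| by apply: normD_le; vec.
  have := normr_ge0 (x - x0).
  have : 0 <= C * (3 + B) * `|x - x0| by rewrite mulr_ge0 // ltW.
  by rewrite /D in xd; lra.
move=> u Ku nu Kgu; rewrite -(sph_dist_opp isoF (etrans nu (esym nx))) (FT _ Ku).1.
rewrite [u + g]addrC -(sph_norm isoF (g + u)) (FT _ Kgu).1 linearD Tg.
by rewrite addrC.
Qed.

End ConvexCone.

Variable F : X -> Y.
Hypothesis isoF : spherical_isometry F.

(** Both signs are included so that the set is symmetric: the distances used to
    control F at - x are those to points near x. *)
Definition agreement : set X := [set z | F z = T z /\ F (- z) = - T z].

Lemma agreement_scale z (a : R) : 0 <= a -> agreement z -> agreement (a *: z).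
Proof.
move=> a0 [Fz FNz]; rewrite /agreement /= -scalerN !(sph_homog isoF) // Fz FNz.
by rewrite linearZ scalerN.
Qed.

Lemma agreement_opp z : agreement z -> agreement (- z).
Proof. by case=> Fz FNz; split; rewrite ?opprK linearN ?opprK. Qed.

Lemma agreement0 : agreement 0.
Proof. by split; rewrite ?oppr0 (sph0 isoF) (linear0 T) // oppr0. Qed.

Lemma agreement_neighbourhood (K : set X) (x0 : X) :
    open_cone K -> (forall x y, K x -> K y -> K (x + y)) -> ~ K 0 -> x0 != 0 ->
    (forall e : R, 0 < e -> exists2 u, K u & `|u - x0| < e) ->
    K `<=` agreement ->
  exists2 d : R, 0 < d & forall x, `|x - x0| < d -> agreement x.
Proof.
move=> coneK addK K0 x0_neq0 x0_adh KF.
have [d d0 dP] := agreement_extends coneK addK K0 x0_neq0 x0_adh isoF KF.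
have [z Kz|d' d'0 d'P] :=
    agreement_extends coneK addK K0 x0_neq0 x0_adh (sph_opp isoF).
  by have [Fz FNz] := KF _ Kz; rewrite opprK FNz Fz opprK.
exists (Num.min d d') => [|x]; first by rewrite lt_min d0.
rewrite lt_min => /andP[/dP FNx /d'P /oppr_inj].
by rewrite opprK => Fx.
Qed.

Definition ball_cone (u : X) (r : R) : set X :=
  [set x | exists2 a : R, 0 < a & `|a *: x - u| < r].

Lemma ball_cone_open_cone u r : open_cone (ball_cone u r).
Proof.
split=> [|k x k0 [a a0 ax]]; last first.
  by exists (a / k); rewrite ?divr_gt0 // scalerA divfK ?gt_eqF.
apply/openP => z [a a0 az]; exists ((r - `|a *: z - u|) / a).
  by rewrite divr_gt0 // subr_gt0.
move=> x; rewrite ltr_pdivlMr // mulrC => xz; exists a => //.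
have : `|a *: x - u| <= `|a *: (x - z)| + `|a *: z - u| by apply: normD_le; vec.
by rewrite normZ_ge0 ?(ltW a0) //; lra.
Qed.

Lemma ball_cone_add u r x y :
  ball_cone u r x -> ball_cone u r y -> ball_cone u r (x + y).
Proof.
move=> [a a0 ax] [b b0 bx]; have ab0 : 0 < a + b by lra.
exists (a * b / (a + b)); first by rewrite divr_gt0 // mulr_gt0.
have -> : (a * b / (a + b)) *: (x + y) - u =
    (b / (a + b)) *: (a *: x - u) + (a / (a + b)) *: (b *: y - u).
  by vfield; rewrite gt_eqF.
rewrite (le_lt_trans (ler_normD _ _)) // !normZ_ge0 ?divr_ge0 ?ltW //.
have -> : r = (b / (a + b)) * r + (a / (a + b)) * r.
  by field; rewrite gt_eqF.
by rewrite ltrD // ltr_pM2l // divr_gt0.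
Qed.

(** Leave the good set along a segment from u1 to a bad y, at the first bad
    point c t0. Just before it there is a good u much closer to the bad set than
    to 0; let l be a bad point nearest to u. The cone over the ball around u
    reaching to l consists of good points, so agreement extends across l. *)
Lemma agreement_all (O : set X) : open O -> O !=set0 -> O `<=` agreement ->
  forall y, agreement y.
Proof.
move=> oO [u1 Ou1] OF y; apply: contrapT => bad_y.
have y0 : y != 0 by apply/eqP => y0; apply: bad_y; rewrite y0; exact: agreement0.
pose good : set X := agreement°.
have near_good : forall z, good z ->
    exists2 r : R, 0 < r & forall x, `|x - z| < r -> good x.
  by have /openP := @open_interior X agreement.
have good_agrees : good `<=` agreement := @interior_subset X agreement.
have good1 : good u1 by move: OF; rewrite open_subsetE //; apply.
pose c (t : R) := u1 + t *: (y - u1).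
pose n1 := 1 + `|y - u1|.
have n1_gt0 : 0 < n1 by rewrite ltr_pwDl.
have dist_c s t : `|c s - c t| <= `|s - t| * n1.
  rewrite (_ : c s - c t = (s - t) *: (y - u1)); last by rewrite /c; vec.
  by rewrite normrZ ler_wpM2l // lerDr.
pose A := [set t : R | 0 <= t /\ ~ good (c t)].
have A1 : A 1.
  split=> // /good_agrees; rewrite /c (_ : _ + _ = y) //; vec.
have infA : has_inf A by split; [exists 1 | exists 0 => t []].
pose t0 := inf A.
have t0_le t : A t -> t0 <= t by apply: ge_inf; exact: infA.2.
have t0_ge0 : 0 <= t0 by apply: lb_le_inf; [exists 1 | move=> t []].
have bad_t0 : ~ good (c t0).
  move=> /near_good[r r0 rP].
  have [s As s_lt] := inf_adherent (divr_gt0 r0 n1_gt0) infA.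
  case: (As) => _; apply; apply: rP; apply: le_lt_trans (dist_c _ _) _.
  rewrite ger0_norm ?subr_ge0 ?t0_le // -ltr_pdivlMr //.
  by rewrite ltrBlDl.
have t0_gt0 : 0 < t0.
  rewrite lt_neqAle t0_ge0 andbT; apply/eqP => t00; apply: bad_t0.
  by rewrite -t00 /c (_ : _ + _ = u1) //; vec.
have z0_neq0 : c t0 != 0.
  apply/eqP => ct0; apply: bad_y.
  have t01 := t0_le _ A1.
  rewrite (_ : y = - (((1 - t0) / t0) *: u1)).
    apply: agreement_opp; apply: agreement_scale (good_agrees _ good1).
    by rewrite divr_ge0 // subr_ge0.
  apply: (scalerI (lt0r_neq0 t0_gt0)).
  rewrite (_ : t0 *: y = c t0 - (1 - t0) *: u1); last by rewrite /c; vec.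
  by rewrite ct0; vfield; rewrite gt_eqF.
have nz0 : 0 < `|c t0| by rewrite normr_gt0.
(* The point c (t0 - h) is good and within a quarter of |c t0| from c t0, so the
   nearest bad point is not 0. *)
pose h := Num.min t0 (`|c t0| / 4 / n1).
have h0 : 0 < h by rewrite lt_min t0_gt0 !divr_gt0.
have [h1 h2] : h <= t0 /\ h * n1 <= `|c t0| / 4.
  by rewrite -ler_pdivlMr // !ge_min !lexx orbT.
have good_u : good (c (t0 - h)).
  apply: contrapT => bad_u.
  have : t0 <= t0 - h by apply: t0_le; split=> //; rewrite subr_ge0.
  by lra.
have uz0 : `|c t0 - c (t0 - h)| <= `|c t0| / 4.
  apply: le_trans (dist_c _ _) _.
  by rewrite (_ : t0 - (t0 - h) = h) ?gtr0_norm //; ring.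
move: (c (t0 - h)) good_u uz0 => u good_u uz0.
pose D := [set `|b - u| | b in ~` good].
have infD : has_inf D.
  split; first by exists `|c t0 - u|, (c t0).
  by exists 0 => _ [b _ <-].
pose rho := inf D.
have rho_le b : ~ good b -> rho <= `|b - u|.
  by move=> bad_b; apply: ge_inf; [exact: infD.2 | exists b].
have /choice[b bP] (n : nat) :
    exists b, ~ good b /\ `|b - u| < rho + n.+1%:R^-1.
  have n_gt0 : 0 < n.+1%:R^-1 :> R by rewrite invr_gt0 ltr0n.
  have [_ [b bad_b <-] lt_b] := inf_adherent n_gt0 infD.
  by exists b.
have bM n : `|b n| <= rho + 1 + `|u|.
  have [_ bn] := bP n.
  have : `|b n| <= `|b n - u| + `|u| by apply: normD_le; vec.
  have : n.+1%:R^-1 <= 1 :> R by rewrite invf_le1 ?ltr0n // ler1n.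
  by move: (n.+1%:R^-1) bn => q *; lra.
have [l lP] := bounded_seq_cluster dimX bM.
have bad_l : ~ good l.
  by move=> /near_good[r r0 rP]; have [n _ /rP] := lP _ r0 0%N; case: (bP n).
have lu : `|l - u| <= rho.
  apply/ler_addgt0Pr => e e0.
  have e2 : 0 < e / 2 by lra.
  have [n Nn bl] := lP _ e2 (Num.truncn (e / 2)^-1).+1.
  have small : n.+1%:R^-1 < e / 2.
    rewrite -[e / 2]invrK ltf_pV2 ?posrE ?invr_gt0 ?ltr0n //.
    by apply: lt_le_trans (truncnS_gt _) _; rewrite ler_nat ltnW.
  have [_ bn] := bP n.
  have : `|l - u| <= `|b n - u| + `|l - b n| by apply: normD_le; vec.
  rewrite [`|l - b n|]distrC; move: (n.+1%:R^-1) bn small => q *; lra.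
have rho_small : rho <= `|c t0| / 4 := le_trans (rho_le _ bad_t0) uz0.
have nu : `|c t0| <= `|c t0 - u| + `|u| by apply: normD_le; vec.
have l_neq_u : l != u by apply/eqP => lu_eq; apply: bad_l; rewrite lu_eq.
have lu0 : 0 < `|l - u| by rewrite normr_gt0 subr_eq0.
have in_ball x : `|x - u| < rho -> good x.
  by move=> xu; apply: contrapT => /rho_le; rewrite leNgt xu.
have [|||e e0|x|d d0 dP] :=
    @agreement_neighbourhood (ball_cone u rho) l (ball_cone_open_cone u rho).
- exact: ball_cone_add.
- by move=> [a _]; rewrite scaler0 sub0r normrN; lra.
- apply/eqP => l0; rewrite l0 sub0r normrN in lu; lra.
(* The vector l is approached from inside the ball, along the segment to u. *)
- pose q := Num.min 1 (e / (2 * `|l - u|)).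
  have q0 : 0 < q by rewrite lt_min ltr01 divr_gt0 // mulr_gt0.
  have [q1 qe] : q <= 1 /\ q * (2 * `|l - u|) <= e.
    by rewrite -ler_pdivlMr ?mulr_gt0 // !ge_min !lexx orbT.
  have qlu : 0 < q * `|l - u| by rewrite mulr_gt0.
  exists (u + (1 - q) *: (l - u)).
    exists 1 => //.
    rewrite (_ : 1 *: _ - u = (1 - q) *: (l - u)); last by vec.
    by rewrite normZ_ge0; lra.
  rewrite (_ : _ - l = (- q) *: (l - u)); last by vec.
  by rewrite scaleNr normrN normZ_ge0 ?(ltW q0) //; lra.
- move=> [a a0 /in_ball/good_agrees ax].
  rewrite (_ : x = a^-1 *: (a *: x)).
    by apply: agreement_scale => //; rewrite invr_ge0 ltW.
  by rewrite scalerA mulVf ?gt_eqF // scale1r.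
apply: bad_l; apply/nbhs_ballP; exists d => // x.
by rewrite -ball_normE /= distrC; exact: dP.
Qed.

End Propagation.

Theorem corollary1p2 (R : realType) (X : completeNormedModType R)
    (dimX : Vector.axiom 3 X)
    (nocone : ~ fixed_direction_cylindrical_open_cone X)
    (fat_star : exists e : X, unit_sphere e /\
       (relative_interior (@unit_sphere R X) (star e) !=set0)) :
  Mazur_Ulam_property X.
Proof.
move=> Y f f_fun f_surj f_iso.
have [e [e1 /(apex_cone_nonempty e1) neG]] := fat_star.
have isoF := radial_extension_isometry f_fun f_surj f_iso.
have [T [G [injT surjT oG neG' GT]]] := linear_patch dimX nocone e1 neG isoF.
have FT := agreement_all dimX nocone injT surjT isoF oG neG' GT.
have normT x : `|T x| = `|x| by rewrite -(FT x).1 (sph_norm isoF).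
exists T; split.
- by move=> y _; have [x <-] := surjT y; exists x.
- by move=> x y _ _; rewrite -(linearB T) normT.
- by move=> x x1; rewrite -(FT x).1 radial_extensionE.
Qed.
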